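(* Let $f\in(\mathbb S^1)^{N\times M}$ with $d_\infty(f)<\frac{\pi}{8}$. Let $\lambda=\{\lambda_k\}_{k\ge0}$ be a sequence of positive reals with $\sum_{k=0}^\infty\lambda_k=\infty$ and $\sum_{k=0}^\infty\lambda_k^2<\infty$, and suppose that $$\sqrt{\varepsilon^2+2\|\lambda\|_2^2L^2c(c+1)}+2\|\lambda\|_\infty cL<\frac{\pi}{16}$$ for some $\varepsilon>0$, where $c=15$ and $L=4$. Assume further that the parameters $\alpha,\beta,\gamma$ of the functional $J$ and $\varepsilon$ satisfy $$\operatorname{TV}_1(f)+\operatorname{TV}_2^{\mathrm{hv}}(f)+\operatorname{TV}_2^{\mathrm d}(f)\le\frac{\varepsilon^2}{m},\qquad m:=\max\{\alpha_1,\alpha_2,\beta_1,\beta_2,\gamma\}.$$ Then the sequence $\{x^{(k)}\}_k$ generated by the cyclic proximal point algorithm for $J$ (started at $x^{(0)}=f$) converges to a global minimizer of $J$ on $(\mathbb S^1)^{N\times M}$.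
   Context: **Circle.** $\mathbb S^1\subset\mathbb R^2$ is the unit circle, $d(p,q)=\arccos\langle p,q\rangle$ its geodesic distance. For $q\in\mathbb S^1$, $\exp_q(t)$ is the rotation of $q$ by the angle $t\in\mathbb R$. For $t\in\mathbb R$, $(t)_{2\pi}\in[-\pi,\pi)$ is the unique point with $t-(t)_{2\pi}\in2\pi\mathbb Z$. Points of $\mathbb S^1$ are represented by $x\in[-\pi,\pi)$ via $\exp_q$ for an arbitrary fixed base point; then $d(x,y)=|(y-x)_{2\pi}|$. **Cyclic differences.** Let $b_2=(1,-2,1)^{\mathrm T}$, $b_{1,1}=(-1,1,1,-1)^{\mathrm T}$. For $w\in\mathbb R^n\setminus\{0\}$ with $\sum_jw_j=0$ and points of $\mathbb S^1$ represented by $x\in[-\pi,\pi)^n$, $d(x;w):=\min_{a\in\mathbb R}|\langle[x+a1_n]_{2\pi},w\rangle|$, where $1_n$ is the all-ones vector, $[t]_{2\pi}=(t)_{2\pi}$ unless $t$ is an odd multiple of $\pi$, in which case $[t]_{2\pi}=\pm\pi$ (both values allowed, independently per component, minimum taken also over these choices). This is independent of the base point. Write $d_2(x)=d(x;b_2)$ and $d_{1,1}(x)=d(x;b_{1,1})$. **Functional.** Let $\mathbb I=\{1,\dots,N\}\times\{1,\dots,M\}$. For parameters $\alpha=(\alpha_1,\alpha_2)$, $\beta=(\beta_1,\beta_2)$, $\gamma$, all nonnegative and not all zero, and data $f\in(\mathbb S^1)^{N\times M}$, $$J(x)=F(x;f)+\alpha\operatorname{TV}_1(x)+\beta\operatorname{TV}_2^{\mathrm{hv}}(x)+\gamma\operatorname{TV}_2^{\mathrm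 d}(x),\quad x\in(\mathbb S^1)^{N\times M},$$ with $F(x;f)=\frac12\sum_{(i,j)\in\mathbb I}d(f_{i,j},x_{i,j})^2$, $$\alpha\operatorname{TV}_1(x)=\alpha_1\sum_{i=1}^{N-1}\sum_{j=1}^{M}d(x_{i,j},x_{i+1,j})+\alpha_2\sum_{i=1}^{N}\sum_{j=1}^{M-1}d(x_{i,j},x_{i,j+1}),$$ $$\beta\operatorname{TV}_2^{\mathrm{hv}}(x)=\beta_1\sum_{i=2}^{N-1}\sum_{j=1}^{M}d_2(x_{i-1,j},x_{i,j},x_{i+1,j})+\beta_2\sum_{i=1}^{N}\sum_{j=2}^{M-1}d_2(x_{i,j-1},x_{i,j},x_{i,j+1}),$$ $$\gamma\operatorname{TV}_2^{\mathrm d}(x)=\gamma\sum_{i=1}^{N-1}\sum_{j=1}^{M-1}d_{1,1}(x_{i,j},x_{i+1,j},x_{i,j+1},x_{i+1,j+1}).$$ $\operatorname{TV}_1(f)$, $\operatorname{TV}_2^{\mathrm{hv}}(f)$, $\operatorname{TV}_2^{\mathrm d}(f)$ written without parameters denote these sums with all weights equal to $1$. **Neighbor distance.** $d_\infty(f):=\max_{(i,j)\in\mathbb I}\max_{(k,l)\in\mathcal N_{i,j}}d(f_{i,j},f_{k,l})$ with $\mathcal N_{i,j}=\{(k,l)\in\mathbb I:|i-k|+|j-l|=1\}$. **Splitting.** $J=\sum_{l=1}^{15}J_l$, where $J_1=F(\cdot;f)$; $J_2,J_3$ are the parts of the $\alpha_1$-sum with $i$ odd, resp. even; $J_4,J_5$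 the parts of the $\alpha_2$-sum with $j$ odd, resp. even; $J_6,J_7,J_8$ the parts of the $\beta_1$-sum with first index $i-1$ of the triple congruent to $1,2,0$ modulo $3$; $J_9,J_{10},J_{11}$ the parts of the $\beta_2$-sum with $j-1$ congruent to $1,2,0$ modulo $3$; $J_{12},\dots,J_{15}$ the four parts of the $\gamma$-sum according to the parities of $(i,j)$. Thus within each $J_l$ the terms involve disjoint sets of pixels. **Algorithm (CPPA).** For a function $\varphi$ on $(\mathbb S^1)^{N\times M}$ and $\mu>0$, $\operatorname{prox}_{\mu\varphi}(g)=\arg\min_{x\in(\mathbb S^1)^{N\times M}}\frac12\sum_{i,j}d(x_{i,j},g_{i,j})^2+\mu\varphi(x)$. Set $x^{(0)}=f$ and, for $k=0,1,2,\dots$ and $l=1,\dots,c$ with $c=15$, $x^{(k+\frac lc)}=\operatorname{prox}_{\lambda_kJ_l}\big(x^{(k+\frac{l-1}c)}\big)$. $\|\lambda\|_2$ and $\|\lambda\|_\infty$ are the $\ell^2$ and $\ell^\infty$ norms of the sequence. *)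

(* Defs.v *)
From HB Require Import structures.
From mathcomp Require Import all_boot all_order all_algebra.
From mathcomp Require Import ring lra.
From mathcomp Require Import all_classical all_reals all_analysis.

Set Implicit Arguments.
Unset Strict Implicit.
Unset Printing Implicit Defensive.

Import Order.TTheory GRing.Theory Num.Theory.
Import numFieldNormedType.Exports.

Local Open Scope classical_set_scope.
Local Open Scope ring_scope.

Definition argmin (R : realType) (T : Type) (phi : T -> R) : set T :=
  [set x | forall y, phi x <= phi y].

Section Circle.
Context {R : realType}.

Definition circle : Type := {p : R * R | p.1 ^+ 2 + p.2 ^+ 2 == 1}.

Definition gdist (p q : circle) : R :=
  acos ((val p).1 * (val q).1 + (val p).2 * (val q).2).

Definition rotate (t : R) (p : R * R) : R * R :=
  (p.1 * cos t - p.2 * sin t, p.1 * sin t + p.2 * cos t).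

Lemma rotate_circle (q : circle) (t : R) :
  (rotate t (val q)).1 ^+ 2 + (rotate t (val q)).2 ^+ 2 == 1.
Proof.
case: q => -[a b] /= /eqP ab1; apply/eqP.
rewrite [RHS](_ : 1 = (a ^+ 2 + b ^+ 2) * (cos t ^+ 2 + sin t ^+ 2)); first ring.
by rewrite ab1 cos2Dsin2 mulr1.
Qed.

Definition circle_exp (q : circle) (t : R) : circle :=
  Sub (rotate t (val q)) (rotate_circle q t).

(* The unique x in [-pi, pi[ representing p with respect to the base point q. *)
Definition circle_log (q p : circle) : R :=
  get [set x | - pi <= x < pi /\ circle_exp q x = p].

Definition wrap (t : R) : R :=
  t - 2 * pi * (Num.floor ((t + pi) / (2 * pi)))%:~R.

Lemma wrapP (t : R) :
  - pi <= wrap t < pi /\ exists k : int, t - wrap t = 2 * pi * k%:~R.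
Proof.
split; last by exists (Num.floor ((t + pi) / (2 * pi))); rewrite /wrap; ring.
have pi2 : 0 < 2 * pi :> R by rewrite mulr_gt0 ?pi_gt0.
have /andP[] := floor_itv ((t + pi) / (2 * pi)).
rewrite ler_pdivlMr // ltr_pdivrMr // intrD /wrap => l1 l2.
apply/andP; split; nra.
Qed.

Definition odd_multiple_pi (t : R) : Prop :=
  exists k : int, t = (2 * k%:~R + 1) * pi.

(* The possible values of [t]_{2 pi}. *)
Definition wrap_values (t : R) : set R :=
  [set s | (~ odd_multiple_pi t /\ s = wrap t) \/
           (odd_multiple_pi t /\ (s = pi \/ s = - pi))].

(* The minimum over the shifts a and over the choices of [_]_{2 pi}.  When the
   weights sum to 0, |<[x + a 1_n]_{2 pi}, w>| takes only finitely many values,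
   so that the infimum below is attained. *)
Definition cyclic_diff (n : nat) (x w : 'rV[R]_n) : R :=
  inf [set v | exists a : R, exists2 y : 'rV[R]_n,
         forall i, wrap_values (x 0 i + a) (y 0 i) &
         v = `|\sum_(i < n) y 0 i * w 0 i| ].

Definition b2 : 'rV[R]_3 := \row_(i < 3) [:: 1; - 2; 1]`_i.
Definition b11 : 'rV[R]_4 := \row_(i < 4) [:: -1; 1; 1; -1]`_i.

Definition d2 (q p1 p2 p3 : circle) : R :=
  cyclic_diff (\row_(i < 3) [seq circle_log q p | p <- [:: p1; p2; p3]]`_i) b2.

Definition d11 (q p1 p2 p3 p4 : circle) : R :=
  cyclic_diff
    (\row_(i < 4) [seq circle_log q p | p <- [:: p1; p2; p3; p4]]`_i) b11.

End Circle.
Arguments circle : clear implicits.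

(* Matrix indices start at 0: row i : 'I_N stands for row i.+1 of the grid
   {1..N}, and likewise for columns. *)
Notation grid R N M := ('M[circle R]_(N, M)).

Section Functional.
Context {R : realType} {N M : nat}.
Implicit Types (q : circle R) (f g x y : grid R N M) (P Q : pred nat).
Implicit Types (alpha beta : R * R) (gamma : R).

Definition fidelity f x : R :=
  2^-1 * \sum_(i < N) \sum_(j < M) gdist (f i j) (x i j) ^+ 2.

(* In the five sums below, P (and Q) select the terms according to the 1-based
   index of their first pixel; predT yields the full sum. *)
Definition tv1_ver P x : R :=
  \sum_(i < N | P i.+1) \sum_(i1 < N | i1 == i.+1 :> nat) \sum_(j < M)
    gdist (x i j) (x i1 j).

Definition tv1_hor P x : R :=
  \sum_(j < M | P j.+1) \sum_(j1 < M | j1 == j.+1 :> nat) \sum_(i < N)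
    gdist (x i j) (x i j1).

Definition tv2_ver q P x : R :=
  \sum_(i < N | P i.+1) \sum_(i1 < N | i1 == i.+1 :> nat)
    \sum_(i2 < N | i2 == i.+2 :> nat) \sum_(j < M)
      d2 q (x i j) (x i1 j) (x i2 j).

Definition tv2_hor q P x : R :=
  \sum_(j < M | P j.+1) \sum_(j1 < M | j1 == j.+1 :> nat)
    \sum_(j2 < M | j2 == j.+2 :> nat) \sum_(i < N)
      d2 q (x i j) (x i j1) (x i j2).

Definition tv2_dia q P Q x : R :=
  \sum_(i < N | P i.+1) \sum_(i1 < N | i1 == i.+1 :> nat)
    \sum_(j < M | Q j.+1) \sum_(j1 < M | j1 == j.+1 :> nat)
      d11 q (x i j) (x i1 j) (x i j1) (x i1 j1).

Definition TV1 alpha x : R :=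
  alpha.1 * tv1_ver predT x + alpha.2 * tv1_hor predT x.

Definition TV2hv q beta x : R :=
  beta.1 * tv2_ver q predT x + beta.2 * tv2_hor q predT x.

Definition TV2d q gamma x : R := gamma * tv2_dia q predT predT x.

Definition J q alpha beta gamma f x : R :=
  fidelity f x + TV1 alpha x + TV2hv q beta x + TV2d q gamma x.

Definition even_pred : pred nat := fun i => ~~ odd i.
Definition mod3 (r : nat) : pred nat := fun i => (i %% 3 == r)%N.

(* Only 1 <= l <= 15 is meaningful. *)
Definition Jpart q alpha beta gamma f (l : nat) x : R :=
  match l with
  | 1 => fidelity f x
  | 2 => alpha.1 * tv1_ver odd x
  | 3 => alpha.1 * tv1_ver even_pred x
  | 4 => alpha.2 * tv1_hor odd x
  | 5 => alpha.2 * tv1_hor even_pred x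
  | 6 => beta.1 * tv2_ver q (mod3 1) x
  | 7 => beta.1 * tv2_ver q (mod3 2) x
  | 8 => beta.1 * tv2_ver q (mod3 0) x
  | 9 => beta.2 * tv2_hor q (mod3 1) x
  | 10 => beta.2 * tv2_hor q (mod3 2) x
  | 11 => beta.2 * tv2_hor q (mod3 0) x
  | 12 => gamma * tv2_dia q odd odd x
  | 13 => gamma * tv2_dia q odd even_pred x
  | 14 => gamma * tv2_dia q even_pred odd x
  | 15 => gamma * tv2_dia q even_pred even_pred x
  | _ => 0
  end.

Let sum_parity n (F : 'I_n -> R) :
  \sum_(i < n) F i
  = \sum_(i < n | odd i.+1) F i + \sum_(i < n | even_pred i.+1) F i.
Proof. exact: (bigID (fun i : 'I_n => odd i.+1)). Qed.

Let sum_mod3 n (F : 'I_n -> R) :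
  \sum_(i < n) F i
  = \sum_(i < n | mod3 1 i.+1) F i + \sum_(i < n | mod3 2 i.+1) F i
    + \sum_(i < n | mod3 0 i.+1) F i.
Proof.
rewrite (bigID (fun i : 'I_n => mod3 1 i.+1)) /= -addrA; congr (_ + _).
rewrite (bigID (fun i : 'I_n => mod3 2 i.+1)) /=; congr (_ + _);
  apply: eq_bigl => i; rewrite /mod3;
  by case: (i.+1 %% 3)%N (ltn_pmod i.+1 (isT : 0 < 3)%N) => [|[|[|]]].
Qed.

Lemma J_split q alpha beta gamma f x :
  J q alpha beta gamma f x =
  \sum_(1 <= l < 16) Jpart q alpha beta gamma f l x.
Proof.
rewrite /index_iota /= !big_cons big_nil /= /J /TV1 /TV2hv /TV2d.
have -> : tv1_ver predT x = tv1_ver odd x + tv1_ver even_pred x.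
  exact: sum_parity.
have -> : tv1_hor predT x = tv1_hor odd x + tv1_hor even_pred x.
  exact: sum_parity.
have -> : tv2_ver q predT x =
    tv2_ver q (mod3 1) x + tv2_ver q (mod3 2) x + tv2_ver q (mod3 0) x.
  exact: sum_mod3.
have -> : tv2_hor q predT x =
    tv2_hor q (mod3 1) x + tv2_hor q (mod3 2) x + tv2_hor q (mod3 0) x.
  exact: sum_mod3.
have dia P : tv2_dia q P predT x = tv2_dia q P odd x + tv2_dia q P even_pred x.
  rewrite -big_split; apply: eq_bigr => i _ /=.
  by rewrite -big_split; apply: eq_bigr => i1 _ /=; exact: sum_parity.
have -> : tv2_dia q predT predT x =
    tv2_dia q odd predT x + tv2_dia q even_pred predT x by exact: sum_parity.
rewrite !dia; ring.
Qed.

Definition dinfty f : R :=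
  \big[Num.max/0]_(i < N) \big[Num.max/0]_(j < M)
    \big[Num.max/0]_(k < N)
      \big[Num.max/0]_(l < M | (`|i%:Z - k%:Z| + `|j%:Z - l%:Z| == 1)%R)
        gdist (f i j) (f k l).

Definition prox (mu : R) (phi : grid R N M -> R) g : set (grid R N M) :=
  argmin (fun x =>
    2^-1 * \sum_(i < N) \sum_(j < M) gdist (x i j) (g i j) ^+ 2 + mu * phi x).

(* The iterate x^(k + l/c) is stored at position c * k + l. *)
Definition is_CPPA (c : nat) (Jl : nat -> grid R N M -> R) (lambda : R^nat) f
    (x : nat -> grid R N M) : Prop :=
  x 0%N = f /\
  forall k l, (1 <= l <= c)%N ->
    prox (lambda k) (Jl l) (x (c * k + l.-1)%N) (x (c * k + l)%N).

(* Convergence in the product of circles for the geodesic distance. *)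
Definition grid_cvg (x : nat -> grid R N M) y : Prop :=
  forall i j, gdist (x n i j) (y i j) @[n --> \oo] --> (0 : R).

End Functional.

Definition l2norm {R : realType} (lambda : R^nat) : R :=
  Num.sqrt (limn (series (fun k => lambda k ^+ 2))).

Definition linfnorm {R : realType} (lambda : R^nat) : R :=
  sup (range (fun k => `|lambda k|)).

(* Main.v *)
Require Import Defs.
From HB Require Import structures.
From mathcomp Require Import all_boot all_order all_algebra.
From mathcomp Require Import ring lra zify.
From mathcomp Require Import all_classical all_reals all_analysis.
Import Order.TTheory GRing.Theory Num.Theory.
Import numFieldNormedType.Exports.
Local Open Scope classical_set_scope.
Local Open Scope ring_scope.
Set Implicit Arguments.
Unset Strict Implicit.
Unset Printing Implicit Defensive.

(** Write a grid near the data [f] as [displace f u], which rotates the pixel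
    [(i, j)] of [f] by the angle [u i j].  As long as all the entries of [u]
    stay below [3 pi / 16], neighboring pixels stay so close together that every
    distance and every cyclic difference in the functional is the absolute value
    of an affine function of [u] ([cyclic_diff_arc], [edge_angle], [d2_edges],
    [d11_edges]).  Each summand of [J] is then a convex function [psi l] of [u]
    ([liftable_Jpart]), and its proximal step on the circle obeys the Euclidean
    inequality
      [|u' - w|^2 <= |u - w|^2 - |u - u'|^2 + 2 mu (psi l w - psi l u')]
    for every competitor [w] in that box ([prox_displacement]).

    The competitor [w = 0], that is, the data themselves, shows that the
    iterates never leave the box ([cycle_bound], [iterate_bound]).  The fidelity
    step divides [|u|^2] by at least [1 + lambda k], and each other step adds at
    most [2 lambda k] times the value of its summand at [f].  Over a cycle this
    makes at most [2 lambda k * eps^2], by the assumption on the total variation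
    of [f].  These two effects balance at [|u|^2] about [2 eps^2], where every
    entry is less than [pi / 8].

    Let [z] minimize the lifted functional [Psi], the sum of the [psi l], over
    the fields with entries at most [pi / 8].  A grid with a smaller value of
    [J] than [f] has fidelity at most [eps^2], so it lies in these coordinates,
    and [displace f z] is a global minimizer ([lifted_minimizer]).  With
    [w = z], the inequalities of one cycle add up to a decrease of [|u - z|^2]
    by [2 lambda k (Psi u - Psi z)], up to an error of order [(lambda k)^2]
    ([cycle_descent]).  The fidelity makes [Psi] strongly convex
    ([quadratic_growth]), so that [|u - z|^2] is contracted by the factor
    [1 - lambda k / 2] up to that error; since the steps are square summable but
    not summable, it tends to [0] ([cvg0_of_contraction]). *)

Local Notation wrap := Defs.wrap.

(** * Angles modulo a full turn *)

Section Angles.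
Context {R : realType}.
Implicit Types (a b t s : R) (q p : circle R).

Definition angle_eq a b : Prop := exists k : int, a - b = 2 * pi * k%:~R.

Lemma angle_eqxx a : angle_eq a a.
Proof. by exists 0; rewrite subrr mulr0. Qed.

Lemma angle_eq_sym a b : angle_eq a b -> angle_eq b a.
Proof. by case=> k kE; exists (- k); rewrite intrN mulrN -kE opprB. Qed.

Lemma angle_eqD a b s t : angle_eq a b -> angle_eq s t ->
  angle_eq (a + s) (b + t).
Proof.
by case=> k kE [l lE]; exists (k + l); rewrite intrD mulrDr -kE -lE; ring.
Qed.

Lemma angle_eqN a b : angle_eq a b -> angle_eq (- a) (- b).
Proof. by case=> k kE; exists (- k); rewrite intrN mulrN -kE; ring. Qed.

Lemma angle_eqB a b s t : angle_eq a b -> angle_eq s t ->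
  angle_eq (a - s) (b - t).
Proof. by move=> ab /angle_eqN; exact: angle_eqD. Qed.

Lemma angle_eq_trans a b t : angle_eq a b -> angle_eq b t -> angle_eq a t.
Proof.
by case=> k kE [l lE]; exists (k + l); rewrite intrD mulrDr -kE -lE; ring.
Qed.

Lemma angle_eq_turn a b t : angle_eq (a - t) b -> angle_eq a (t + b).
Proof.
by move=> h; rewrite -(subrK t a) addrC; apply: angle_eqD (angle_eqxx t) h.
Qed.

Lemma angle_eqMz a b (z : int) : angle_eq a b ->
  angle_eq (a * z%:~R) (b * z%:~R).
Proof. by case=> k kE; exists (k * z); rewrite intrM mulrA -kE mulrBl. Qed.

Lemma angle_eq_sum (I : Type) (r : seq I) (F G : I -> R) :
  (forall i, angle_eq (F i) (G i)) ->
  angle_eq (\sum_(i <- r) F i) (\sum_(i <- r) G i).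
Proof.
move=> FG; elim/big_ind2 : _ => [|a b s t|i _]; [exact: angle_eqxx| |exact: FG].
exact: angle_eqD.
Qed.

Lemma angle_eq_wrap t : angle_eq t (wrap t).
Proof. by case: (wrapP t). Qed.

Lemma wrap_bounds t : - pi <= wrap t < pi.
Proof. by case: (wrapP t). Qed.

Lemma norm_wrap_lepi t : `|wrap t| <= pi.
Proof. by rewrite ler_norml; have /andP[-> /ltW ->] := wrap_bounds t. Qed.

(** Distinct integer multiples of a full turn are at least a full turn
    apart. *)
Lemma angle_eq_small a b : angle_eq a b -> `|a - b| < 2 * pi -> a = b.
Proof.
case=> k kE; rewrite kE normrM (@ger0_norm _ (2 * pi)); last first.
  by rewrite mulr_ge0 ?pi_ge0.
rewrite -intr_norm gtr_pMr; last by rewrite mulr_gt0 ?pi_gt0.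
rewrite (ltrz1 R) => k1; apply/eqP; rewrite -subr_eq0 kE.
suff -> : k = 0 by rewrite mulr0.
by apply/eqP; rewrite -normr_le0 -ltzD1 add0r.
Qed.

Lemma wrap_uniq t s : angle_eq t s -> - pi <= s < pi -> wrap t = s.
Proof.
move=> ts /andP[s1 s2]; apply: angle_eq_small.
  exact: angle_eq_trans (angle_eq_sym (angle_eq_wrap t)) ts.
have /andP[w1 w2] := wrap_bounds t.
by rewrite ltr_norml; apply/andP; split; lra.
Qed.

Lemma norm_wrap_le t s : angle_eq t s -> `|wrap t| <= `|s|.
Proof.
move=> ts; have [spi|pis] := ltP `|s| pi.
  rewrite (wrap_uniq ts) //.
  by move: spi; rewrite ltr_norml => /andP[/ltW -> ->].
exact: le_trans (norm_wrap_lepi t) pis.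
Qed.

Lemma norm_wrapE t s : angle_eq t s -> `|s| < pi -> `|wrap t| = `|s|.
Proof.
move=> ts; rewrite ltr_norml => /andP[/ltW s1 s2].
by rewrite (wrap_uniq ts) ?s1.
Qed.

Lemma cos_sin_angle_eq a b : angle_eq a b -> cos a = cos b /\ sin a = sin b.
Proof.
case=> k kE; have {kE} -> : a = b + 2 * pi * k%:~R by rewrite -kE; ring.
have nat_turns (c : R) (n : nat) : cos (c + 2 * pi * n%:R) = cos c /\
    sin (c + 2 * pi * n%:R) = sin c.
  have -> : 2 * pi * n%:R = (pi *+ 2) *+ n :> R.
    by rewrite -(mulr_natl pi) mulr_natr.
  by rewrite (periodicn (@cosD2pi R)) (periodicn (@sinD2pi R)).
case: k => n; first exact: nat_turns.
rewrite NegzE; have [<- <-] := nat_turns (b + 2 * pi * (- n.+1%:Z)%:~R) n.+1.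
by rewrite intrN -addrA -mulrDr addNr mulr0 addr0.
Qed.

Lemma acos_cos t : acos (cos t) = `|wrap t|.
Proof.
have [-> _] := cos_sin_angle_eq (angle_eq_wrap t).
have /andP[w1 w2] := wrap_bounds t.
have [w0|w0] := leP 0 (wrap t).
  by rewrite ger0_norm // cosK // in_itv /= w0 ltW.
by rewrite ltr0_norm // cosKN // w1 ltW.
Qed.

(** * Rotations of the circle *)

Lemma circle_normE q : (val q).1 ^+ 2 + (val q).2 ^+ 2 = 1.
Proof. by case: q => p /= /eqP. Qed.

Lemma circle_exp_angle_eq q a b :
  angle_eq a b -> circle_exp q a = circle_exp q b.
Proof.
by move=> /cos_sin_angle_eq[ca sa]; apply/val_inj; rewrite /= /rotate ca sa.
Qed.

Lemma circle_expD q a b : circle_exp (circle_exp q a) b = circle_exp q (a + b).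
Proof.
by apply/val_inj; rewrite /= /rotate /= cosD sinD; congr (_, _); ring.
Qed.

Lemma circle_exp0 q : circle_exp q 0 = q.
Proof.
apply/val_inj; rewrite /= /rotate cos0 sin0 !mulr1 !mulr0 subr0 add0r.
by case: (val q).
Qed.

Lemma gdist_exp q a b :
  gdist (circle_exp q a) (circle_exp q b) = `|wrap (b - a)|.
Proof.
rewrite -acos_cos /gdist cosB /= ; congr acos.
have q1 := circle_normE q.
set x := (val q).1 in q1 *; set y := (val q).2 in q1 *.
by rewrite -[RHS]mul1r -q1; ring.
Qed.

Lemma circle_exp_inj q a b : circle_exp q a = circle_exp q b -> angle_eq a b.
Proof.
move=> ab; have := gdist_exp q b b; have := gdist_exp q b a.
rewrite ab => -> /eqP; rewrite subrr (wrap_uniq (angle_eqxx 0)); last first.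
  by rewrite oppr_le0 pi_ge0 pi_gt0.
rewrite normr0 normr_eq0 => /eqP w0.
by have [k] := angle_eq_wrap (a - b); rewrite w0 subr0; exists k.
Qed.

Lemma circle_exp_surj q p : exists t, circle_exp q t = p.
Proof.
have q1 := circle_normE q; have p1 := circle_normE p.
set x := (val q).1 in q1 *; set y := (val q).2 in q1 *.
set z := (val p).1 in p1 *; set w := (val p).2 in p1 *.
pose c := x * z + y * w; pose s := x * w - y * z.
have cs1 : c ^+ 2 + s ^+ 2 = 1.
  transitivity ((x ^+ 2 + y ^+ 2) * (z ^+ 2 + w ^+ 2)).
    by rewrite /c /s; ring.
  by rewrite q1 p1 mulr1.
have c1 : -1 <= c <= 1.
  by apply/andP; split; nra.
suff [t [ct st]] : exists t, cos t = c /\ sin t = s.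
  exists t; apply/val_inj; rewrite /= /rotate -/x -/y ct st.
  rewrite [val p]surjective_pairing.
  by congr (_, _); rewrite -/z -/w /c /s -[RHS]mul1r -q1; ring.
have cK : cos (acos c) = c by rewrite acosK // in_itv.
have sK : sin (acos c) = `|s|.
  by rewrite sin_acos // -cs1 addrAC subrr add0r sqrtr_sqr.
have [s0|s0] := leP 0 s; first by exists (acos c); rewrite sK ger0_norm.
by exists (- acos c); rewrite cosN sinN sK ltr0_norm // opprK.
Qed.

Lemma circle_logP q p :
  - pi <= circle_log q p < pi /\ circle_exp q (circle_log q p) = p.
Proof.
rewrite /circle_log; set P := mkset _; apply: (@getPex _ P).
have [t tE] := circle_exp_surj q p; exists (wrap t); split.
  exact: wrap_bounds.
rewrite -tE; exact: circle_exp_angle_eq (angle_eq_sym (angle_eq_wrap t)).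
Qed.

Lemma circle_logK q p : circle_exp q (circle_log q p) = p.
Proof. by case: (circle_logP q p). Qed.

Lemma circle_log_exp q t : angle_eq (circle_log q (circle_exp q t)) t.
Proof. by apply/(@circle_exp_inj q); rewrite circle_logK. Qed.

(** * Cyclic differences of nearby points *)

(** Choosing the cut opposite to one of the points identifies the arc that
    carries all of them with an interval, where the cyclic difference is the
    ordinary one; every other cut changes it by a multiple of a full turn,
    which cannot make it smaller in absolute value. *)
Lemma cyclic_diff_arc n (x w eta : 'rV[R]_n) (i0 : 'I_n) :
  (forall i, angle_eq (x 0 i) (eta 0 i)) ->
  (forall i, `|eta 0 i - eta 0 i0| < pi) ->
  (forall i, exists z : int, w 0 i = z%:~R) ->
  \sum_i w 0 i = 0 ->
  `|\sum_i eta 0 i * w 0 i| < pi ->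
  cyclic_diff x w = `|\sum_i eta 0 i * w 0 i|.
Proof.
move=> x_eta arc w_int w0 small.
have wrap_angle t y : wrap_values t y -> angle_eq t y.
  move=> [[_ ->]|[[k ->] [->|->]]]; first exact: angle_eq_wrap.
    by exists k; ring.
  by exists (k + 1); rewrite intrD; ring.
have shift a : \sum_i (eta 0 i + a) * w 0 i = \sum_i eta 0 i * w 0 i.
  under eq_bigr do rewrite mulrDl.
  by rewrite big_split /= -mulr_sumr w0 mulr0 addr0.
rewrite /cyclic_diff; set S := mkset _.
have S_lb : lbound S `|\sum_i eta 0 i * w 0 i|.
  move=> _ [a [y ya ->]]; rewrite -(shift a).
  have eq_sums : angle_eq (\sum_i (eta 0 i + a) * w 0 i) (\sum_i y 0 i * w 0 i).
    apply: angle_eq_sum => i; have [z ->] := w_int i; apply: angle_eqMz.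
    apply: angle_eq_trans (wrap_angle _ _ (ya i)); apply: angle_eqD.
      exact: angle_eq_sym.
    exact: angle_eqxx.
  rewrite -(norm_wrapE (angle_eqxx _)) ?shift // -{1}(shift a).
  exact: norm_wrap_le.
have S_mem : S `|\sum_i eta 0 i * w 0 i|.
  exists (- eta 0 i0), (\row_i (eta 0 i - eta 0 i0)) => [i|]; last first.
    congr `|_|; rewrite -(shift (- eta 0 i0)).
    by apply: eq_bigr => i _; rewrite mxE.
  rewrite mxE; left.
  have xy : angle_eq (x 0 i - eta 0 i0) (eta 0 i - eta 0 i0).
    by apply: angle_eqB => //; exact: angle_eqxx.
  have := arc i; rewrite ltr_norml => /andP[a1 a2].
  split; last by rewrite (wrap_uniq xy) // a2 ltW.
  move=> [k kE]; have /angle_eq_small E : angle_eq pi (eta 0 i - eta 0 i0).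
    apply: angle_eq_trans xy; rewrite kE; exists (- k); rewrite intrN; ring.
  have := pi_gt0 R => pi0.
  have : pi = eta 0 i - eta 0 i0.
    by apply: E; rewrite ltr_norml; apply/andP; split; lra.
  by move=> piE; move: a2; rewrite -piE ltxx.
apply/le_anti/andP; split.
  by apply: ge_inf => //; exists `|\sum_i eta 0 i * w 0 i|.
by apply: lb_le_inf => //; exists `|\sum_i eta 0 i * w 0 i|.
Qed.

End Angles.

(** * Convex functions of a displacement field *)

Section Fields.
Context {R : realType} {N M : nat}.
Local Notation V := 'M[R]_(N, M).
Implicit Types (u v w z : V) (r rho t mu : R) (psi phi : V -> R).

Definition dot u v : R := \sum_i \sum_j u i j * v i j.
Definition sqnorm u : R := dot u u.

Lemma sqnormE u : sqnorm u = \sum_i \sum_j u i j ^+ 2.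
Proof. by apply: eq_bigr => i _; apply: eq_bigr => j _; rewrite expr2. Qed.

Lemma dotDl u v w : dot (u + v) w = dot u w + dot v w.
Proof.
rewrite /dot -big_split; apply: eq_bigr => i _; rewrite -big_split /=.
by apply: eq_bigr => j _; rewrite mxE mulrDl.
Qed.

Lemma dotC u v : dot u v = dot v u.
Proof. by apply: eq_bigr => i _; apply: eq_bigr => j _; rewrite mulrC. Qed.

Lemma dotZl t u v : dot (t *: u) v = t * dot u v.
Proof.
rewrite /dot mulr_sumr; apply: eq_bigr => i _; rewrite mulr_sumr.
by apply: eq_bigr => j _; rewrite mxE mulrA.
Qed.

Lemma dotNl u v : dot (- u) v = - dot u v.
Proof. by rewrite -scaleN1r dotZl mulN1r. Qed.

Lemma sqnormD u v : sqnorm (u + v) = sqnorm u + 2 * dot u v + sqnorm v.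
Proof.
rewrite /sqnorm dotDl (dotC u) (dotC v (u + v)) !dotDl (dotC v u); ring.
Qed.

Lemma sqnormZ t u : sqnorm (t *: u) = t ^+ 2 * sqnorm u.
Proof. by rewrite /sqnorm dotZl dotC dotZl mulrA. Qed.

Lemma sqnormN u : sqnorm (- u) = sqnorm u.
Proof. by rewrite -scaleN1r sqnormZ sqrrN expr1n mul1r. Qed.

Lemma sqnormBC u v : sqnorm (u - v) = sqnorm (v - u).
Proof. by rewrite -opprB sqnormN. Qed.

Lemma sqnorm0 : sqnorm 0 = 0.
Proof. by rewrite -(scale0r 0) sqnormZ expr0n mul0r. Qed.

Lemma sqr_entry_le u i j : u i j ^+ 2 <= sqnorm u.
Proof.
rewrite sqnormE (bigD1 i) //= (bigD1 j) //= -addrA lerDl addr_ge0 ?sumr_ge0 //.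
  by move=> *; exact: sqr_ge0.
by move=> *; apply: sumr_ge0 => *; exact: sqr_ge0.
Qed.

Lemma sqnorm_ge0 u : 0 <= sqnorm u.
Proof.
rewrite sqnormE sumr_ge0 // => i _; rewrite sumr_ge0 // => j _; exact: sqr_ge0.
Qed.

Lemma sqnormD_le u v : sqnorm (u + v) <= 2 * sqnorm u + 2 * sqnorm v.
Proof.
have := sqnorm_ge0 (u - v); rewrite !sqnormD sqnormN dotC dotNl (dotC u v) => h.
lra.
Qed.

Definition box r u : Prop := forall i j, `|u i j| < r.

Lemma box0 r : 0 < r -> box r 0.
Proof. by move=> r0 i j; rewrite mxE normr0. Qed.

Lemma box_segment r u v t : box r u -> box r v -> 0 <= t <= 1 ->
  box r (u + t *: (v - u)).
Proof.
move=> ur vr /andP[t0 t1] i j; rewrite !mxE.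
move: (ur i j) (vr i j); rewrite !ltr_norml => /andP[u1 u2] /andP[v1 v2].
by have [uv|/ltW uv] := leP (u i j) (v i j); apply/andP; split; nra.
Qed.

(** The Lipschitz bound is squared so that it passes to sums without square
    roots. *)
Record tame r psi : Prop := Tame {
  tame_ge0 : forall u, 0 <= psi u;
  tame_convex : forall u v t, 0 <= t <= 1 ->
    psi (u + t *: (v - u)) <= psi u + t * (psi v - psi u);
  tame_lipschitz : exists2 K, 0 <= K & forall u v, box r u -> box r v ->
    (psi u - psi v) ^+ 2 <= K * sqnorm (u - v) }.

Lemma tame0 r : tame r (fun=> 0).
Proof.
split=> [//|u v t _|]; first by rewrite subrr mulr0 addr0.
by exists 0 => // u v _ _; rewrite subrr expr0n mul0r.
Qed.

Lemma tameD r psi phi : tame r psi -> tame r phi ->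
  tame r (fun u => psi u + phi u).
Proof.
move=> [p1 p2 [K K0 p3]] [q1 q2 [L L0 q3]]; split => [u|u v t t01|].
- by rewrite addr_ge0.
- by have := p2 u v t t01; have := q2 u v t t01; lra.
- exists (2 * K + 2 * L) => [|u v ur vr]; first by lra.
  have := p3 u v ur vr; have := q3 u v ur vr; have := sqnorm_ge0 (u - v).
  have := sqr_ge0 ((psi u - psi v) - (phi u - phi v)); nra.
Qed.

Lemma tameZ r psi a : 0 <= a -> tame r psi -> tame r (fun u => a * psi u).
Proof.
move=> a0 [p1 p2 [K K0 p3]]; split => [u|u v t t01|]; first by rewrite mulr_ge0.
  by have := ler_wpM2l a0 (p2 u v t t01); lra.
exists (a ^+ 2 * K) => [|u v ur vr]; first by rewrite mulr_ge0 ?sqr_ge0.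
by rewrite -mulrBr exprMn -mulrA ler_wpM2l ?sqr_ge0 ?p3.
Qed.

Lemma tame_sum r (I : Type) (s : seq I) (F : I -> V -> R) :
  (forall i, tame r (F i)) -> tame r (fun u => \sum_(i <- s) F i u).
Proof.
move=> tF; elim: s => [|i s IH].
  by under eq_fun do rewrite big_nil; exact: tame0.
by under eq_fun do rewrite big_cons; exact: tameD.
Qed.

(** Affine functions are described by the two facts from which the triangle
    inequality derives the convexity and the Lipschitz bound of [`|g|]. *)
Definition affine (g : V -> R) : Prop :=
  (forall u v t, g (u + t *: (v - u)) = g u + t * (g v - g u)) /\
  exists2 K, 0 <= K & forall u v, (g u - g v) ^+ 2 <= K * sqnorm (u - v).

Lemma affine_cst a : affine (fun=> a).
Proof.
split=> [u v t|]; first by rewrite subrr mulr0 addr0.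
by exists 0 => // u v; rewrite subrr expr0n mul0r.
Qed.

Lemma affine_entry i j : affine (fun u => u i j).
Proof.
split=> [u v t|]; first by rewrite !mxE.
exists 1 => // u v; rewrite mul1r.
by have := sqr_entry_le (u - v) i j; rewrite !mxE.
Qed.

Lemma affineD g h : affine g -> affine h -> affine (fun u => g u + h u).
Proof.
move=> [p2 [K K0 p3]] [q2 [L L0 q3]]; split => [u v t|].
  by rewrite p2 q2; ring.
exists (2 * K + 2 * L) => [|u v]; first by lra.
have := p3 u v; have := q3 u v; have := sqnorm_ge0 (u - v).
have := sqr_ge0 ((g u - g v) - (h u - h v)); nra.
Qed.

Lemma affineN g : affine g -> affine (fun u => - g u).
Proof.
move=> [p2 [K K0 p3]]; split => [u v t|]; first by rewrite p2; ring.
by exists K => // u v; rewrite -opprD sqrrN.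
Qed.

Lemma tame_norm_affine r g : affine g -> tame r (fun u => `|g u|).
Proof.
move=> [p2 [K K0 p3]]; split => [//|u v t /andP[t0 t1]|].
  rewrite p2 (_ : g u + _ = (1 - t) * g u + t * g v); last by ring.
  apply: le_trans (ler_normD _ _) _; rewrite !normrM (ger0_norm t0).
  by rewrite (@ger0_norm _ (1 - t)) ?subr_ge0 //; lra.
exists K => // u v _ _; apply: le_trans (p3 u v).
rewrite -[leRHS]real_normK ?num_real // -[leLHS]real_normK ?num_real //.
by rewrite lerXn2r ?nnegrE //; exact: ler_dist_dist.
Qed.

Lemma sqnorm_segment u v t : sqnorm (u + t *: (v - u)) =
  (1 - t) * sqnorm u + t * sqnorm v - t * (1 - t) * sqnorm (v - u).
Proof.
rewrite !sqnormD sqnormN sqnormZ sqnormD sqnormN !(dotC _ (t *: _)) dotZl.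
by rewrite dotDl dotNl (dotC v (- u)) dotNl (dotC v u) -/(sqnorm u); ring.
Qed.

Lemma cauchy_schwarz u v : dot u v ^+ 2 <= sqnorm u * sqnorm v.
Proof.
have [v0|v0] := ltP 0 (sqnorm v).
  have := sqnorm_ge0 (sqnorm v *: u - dot u v *: v).
  rewrite sqnormD sqnormN !sqnormZ dotZl (dotC u (- _)) dotNl dotZl (dotC v u).
  move=> h.
  by rewrite -(ler_pM2l v0); lra.
suff -> : v = 0.
  by rewrite -(scale0r 0) dotC dotZl mul0r expr0n mulr_ge0 ?sqnorm_ge0.
apply/matrixP => i j; rewrite mxE; apply/eqP; rewrite -sqrf_eq0.
by rewrite eq_le sqr_ge0 (le_trans (sqr_entry_le v i j)).
Qed.

Lemma sqnorm_box r u : box r u -> sqnorm u <= \sum_(i < N) \sum_(j < M) r ^+ 2.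
Proof.
move=> ur; rewrite sqnormE.
apply: ler_sum => i _; apply: ler_sum => j _; rewrite -real_normK ?num_real //.
by rewrite lerXn2r ?nnegrE ?(ltW (ur i j)) // (le_trans _ (ltW (ur i j))).
Qed.

Lemma tame_half_sqnorm r : tame r (fun u => 2^-1 * sqnorm u).
Proof.
split => [u|u v t /andP[t0 t1]|].
- by rewrite mulr_ge0 ?sqnorm_ge0.
- rewrite sqnorm_segment; have := sqnorm_ge0 (v - u).
  move=> h; suff: 0 <= t * (1 - t) * sqnorm (v - u) by lra.
  by rewrite !mulr_ge0 ?subr_ge0.
have B0 : 0 <= \sum_(i < N) \sum_(j < M) r ^+ 2.
  by apply: sumr_ge0 => *; apply: sumr_ge0 => *; exact: sqr_ge0.
exists (\sum_(i < N) \sum_(j < M) r ^+ 2) => // u v.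
move=> /sqnorm_box ur /sqnorm_box vr.
have -> : 2^-1 * sqnorm u - 2^-1 * sqnorm v = 2^-1 * dot (u + v) (u - v).
  rewrite dotDl !(dotC _ (u - v)) !dotDl !dotNl (dotC v u) -!/(sqnorm _).
  by ring.
rewrite exprMn; have := cauchy_schwarz (u + v) (u - v).
have := sqnormD_le u v; have := sqnorm_ge0 (u - v); nra.
Qed.

(** * Proximal steps *)

Lemma ge0_of_affine_ge0 a b :
  (forall t, 0 < t <= 1 -> 0 <= a + t * b) -> 0 <= a.
Proof.
move=> h; rewrite leNgt; apply/negP => a0.
have h1 := h 1; rewrite mul1r ltr01 lexx in h1; have {}h1 := h1 isT.
have ba : 0 < b - a by lra.
have /h : 0 < - a / (b - a) <= 1.
  by rewrite divr_gt0 ?oppr_gt0 //= ler_pdivrMr //; lra.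
have -> : a + - a / (b - a) * b = - (a ^+ 2 / (b - a)).
  by field; rewrite gt_eqF.
by rewrite oppr_ge0 leNgt divr_gt0 // exprn_even_gt0 //= lt_eqF.
Qed.

(** First-order optimality of a proximal step, tested along the segment from
    its result to [z]. *)
Lemma prox_step_le r psi mu u u' z : tame r psi -> 0 <= mu ->
  box r u' -> box r z ->
  (forall w, box r w ->
    2^-1 * sqnorm (u' - u) + mu * psi u'
      <= 2^-1 * sqnorm (w - u) + mu * psi w) ->
  sqnorm (u' - z) <=
    sqnorm (u - z) - sqnorm (u - u') + 2 * mu * (psi z - psi u').
Proof.
move=> [_ cvx _] mu0 u'r zr u'min.
suff opt : 0 <= dot (u' - u) (z - u') + mu * (psi z - psi u').
  have := sqnormD (u - u') (u' - z); rewrite addrA subrK => ->.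
  move: opt; rewrite -(opprB u u') dotNl -(opprB u' z) dotC dotNl dotC opprK.
  lra.
apply: (@ge0_of_affine_ge0 _ (2^-1 * sqnorm (z - u'))) => t /andP[t0 t1].
have t01 : 0 <= t <= 1 by rewrite ltW.
have := u'min _ (box_segment u'r zr t01).
have := ler_wpM2l mu0 (cvx u' z t t01).
rewrite (addrAC u' _ (- u)) (sqnormD (u' - u)) sqnormZ (dotC _ (t *: _)).
rewrite dotZl (dotC (z - u')) => h1 h2.
by rewrite -(pmulr_rge0 _ t0); lra.
Qed.

(** * Minimizers of tame functions *)

Definition closed_box rho u : Prop := forall i j, `|u i j| <= rho.

Lemma closed_box_box r rho u : rho < r -> closed_box rho u -> box r u.
Proof. by move=> h ur i j; exact: le_lt_trans (ur i j) h. Qed.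

Lemma closed_box0 rho : 0 <= rho -> closed_box rho 0.
Proof. by move=> h i j; rewrite mxE normr0. Qed.

Lemma closed_box_segment rho u v t : closed_box rho u -> closed_box rho v ->
  0 <= t <= 1 -> closed_box rho (u + t *: (v - u)).
Proof.
move=> ur vr /andP[t0 t1] i j; rewrite !mxE.
move: (ur i j) (vr i j); rewrite !ler_norml => /andP[u1 u2] /andP[v1 v2].
by apply/andP; split; nra.
Qed.

Lemma sqnorm_closed_box rho u : 0 <= rho -> sqnorm u <= rho ^+ 2 ->
  closed_box rho u.
Proof.
move=> rho0 ur i j; rewrite -(ler_pXn2r (n := 2)) ?nnegrE //.
by rewrite real_normK ?num_real // (le_trans (sqr_entry_le u i j)).
Qed.

Lemma tame_minimizer r rho psi : 0 <= rho < r -> tame r psi ->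
  exists2 z, closed_box rho z & forall u, closed_box rho u -> psi z <= psi u.
Proof.
move=> /andP[rho0 rhor] [_ _ [K K0 lip]].
pose A : set 'rV[R]_(N * M) :=
  [set v | forall k, `[- rho, rho]%classic (v ord0 k)].
have Abox (a : 'rV[R]_(N * M)) : A a -> closed_box rho (vec_mx a).
  move=> Aa i j; rewrite !mxE; have := Aa (mxvec_index i j).
  by rewrite /= in_itv /= ler_norml.
have A0 : A !=set0.
  by exists 0 => k; rewrite mxE /= in_itv /= oppr_le0 rho0.
have cA : compact A.
    apply: (@rV_compact _ _ (fun=> `[- rho, rho]%classic)) => _.
    exact: segment_compact.
have cont : {within A, continuous (fun a => psi (vec_mx a))}.
  apply/subspace_continuousP => v Av; apply/cvgrPdist_lt => e e0.
  pose c := K * (\sum_(i < N) \sum_(j < M) 1) + 1.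
  have c1 : 1 <= c.
    by rewrite lerDr mulr_ge0 // sumr_ge0 // => *; exact: sumr_ge0.
  have c0 : 0 < c by lra.
  near=> w.
  have Aw : A w by near: w; exact: withinT.
  have vw : ball v (e / c) w.
    by near: w; apply: cvg_within; apply: nbhsx_ballx; rewrite divr_gt0.
  have : sqnorm (vec_mx v - vec_mx w) <= \sum_(i < N) \sum_(j < M) (e / c) ^+ 2.
    by apply: sqnorm_box => i j; rewrite !mxE; case: vw => _; exact.
  have -> : \sum_(i < N) \sum_(j < M) (e / c) ^+ 2 =
      (e / c) ^+ 2 * \sum_(i < N) \sum_(j < M) 1.
    rewrite mulr_sumr; apply: eq_bigr => i _; rewrite mulr_sumr.
    by apply: eq_bigr => j _; rewrite mulr1.
  move=> /(ler_wpM2l K0) le1.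
  have le2 := lip _ _ (closed_box_box rhor (Abox _ Av))
    (closed_box_box rhor (Abox _ Aw)).
  rewrite -(ltr_pXn2r (n := 2)) ?nnegrE ?(ltW e0) //.
  rewrite real_normK ?num_real //; apply: le_lt_trans (le_trans le2 le1) _.
  have -> : K * ((e / c) ^+ 2 * (\sum_(i < N) \sum_(j < M) 1)) =
      e ^+ 2 * ((c - 1) / c ^+ 2) by rewrite /c; field; rewrite -/c gt_eqF.
  rewrite gtr_pMr ?exprn_gt0 // ltr_pdivrMr ?exprn_gt0 //; nra.
have [v /set_mem vA vmin] := compact_EVT_min A0 cA cont.
exists (vec_mx v) => [|u ur]; first exact: Abox.
rewrite -(mxvecK u); apply: vmin; apply/mem_set.
by case/mxvec_indexP => i j /=; rewrite mxvecE in_itv /= -ler_norml.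
Unshelve. all: by end_near. Qed.

End Fields.

(** * Convergence of the cyclic scheme *)

Section Scalar.
Context {R : realType}.
Implicit Types e lam : R^nat.

(** Since the steps are not summable, the decrements force [e] to return below
    any threshold infinitely often; afterwards it can only grow by a tail of the
    summable errors. *)
Lemma cvg0_of_contraction e lam C :
  (forall k, 0 <= e k) -> (forall k, 0 < lam k) -> 0 <= C ->
  series lam @ \oo --> +oo -> cvgn (series (fun k => lam k ^+ 2)) ->
  (forall k, e k.+1 <= e k - 2^-1 * lam k * e k + C * lam k ^+ 2) ->
  e @ \oo --> 0.
Proof.
move=> e0 lam0 C0 lam_div sq_cvg step.
pose L := series lam; pose S := series (fun k => lam k ^+ 2).
have LS n : L n.+1 = L n + lam n by rewrite /L /series /= big_nat_recr.
have SS n : S n.+1 = S n + lam n ^+ 2 by rewrite /S /series /= big_nat_recr.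
have S_nd : nondecreasing_seq S.
  by apply/nondecreasing_seqP => n; rewrite SS lerDl sqr_ge0.
have S_le n : S n <= limn S by exact: nondecreasing_cvgn_le.
have L_nd : nondecreasing_seq L.
  by apply/nondecreasing_seqP => n; rewrite LS lerDl ltW.
have grow k n : (k <= n)%N -> e n + C * S k <= e k + C * S n.
  move/subnK <-; elim: (n - k)%N => [|p IH]; first by rewrite add0n.
  rewrite addSn SS; have := step (p + k)%N.
  have : 0 <= lam (p + k)%N * e (p + k)%N by rewrite mulr_ge0 // ltW.
  lra.
apply/cvgr0Pnorm_le => d d0.
have [K _ SK] : \forall n \near \oo, limn S - d / 2 / (C + 1) <= S n.
  apply: (cvgr_ge (limn S)) => //.
  by rewrite ltrBlDr ltrDl !divr_gt0 // ltr_wpDl.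
have [k Kk ek] : exists2 k, (K <= k)%N & e k < d / 2.
  apply/not_exists2P => no.
  have big k : (K <= k)%N -> d / 2 <= e k.
    by move=> Kk; case: (no k) => // /negP; rewrite -leNgt.
  have low n : (K <= n)%N ->
      e n + d / 4 * (L n - L K) + C * S K <= e K + C * S n.
    move/subnK <-; elim: (n - K)%N => [|p IH].
      by rewrite add0n subrr mulr0 addr0.
    rewrite addSn SS LS; have := step (p + K)%N.
    have := ler_wpM2l (ltW (lam0 (p + K)%N)) (big (p + K)%N (leq_addl _ _)).
    lra.
  have [n _ Ln] : \forall n \near \oo,
      L K + (e K + C * (limn S - S K) + 1) / (d / 4) <= L n.
    by move/cvgryPge: lam_div; exact.
  have := Ln (maxn K n) (leq_maxr _ _).
  rewrite -lerBrDl ler_pdivrMr ?divr_gt0 //.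
  have := low _ (leq_maxl K n); have := e0 (maxn K n).
  have := ler_wpM2l C0 (S_le (maxn K n)).
  by move=> *; lra.
exists k => // n /= kn; rewrite ger0_norm //.
have := grow _ _ kn; have := ler_wpM2l C0 (S_le n).
have := SK _ Kk; rewrite lerBlDr => /(ler_wpM2l C0).
have : C * (d / 2 / (C + 1)) <= d / 2.
  rewrite mulrA ler_pdivrMr ?ltr_wpDl // mulrC ler_wpM2l ?lerDl //.
  by rewrite divr_ge0 // ltW.
by move=> *; lra.
Qed.

End Scalar.

Section Convergence.
Context {R : realType} {N M : nat}.
Local Notation V := 'M[R]_(N, M).
Variables (r rho : R) (c : nat) (psi : nat -> V -> R) (lam : R^nat).
Variable u : nat -> V.
Hypothesis rho_r : rho < r.
Hypothesis psi_tame : forall l, tame r (psi l).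
Hypothesis psi1 : forall w, psi 1%N w = 2^-1 * sqnorm w.
Hypothesis c_gt0 : (0 < c)%N.
Hypothesis lam_gt0 : forall k, 0 < lam k.
Hypothesis u_box : forall n, closed_box rho (u n).
Hypothesis u_step : forall k l w, (1 <= l <= c)%N -> box r w ->
  sqnorm (u (c * k + l)%N - w) <= sqnorm (u (c * k + l.-1)%N - w)
    - sqnorm (u (c * k + l.-1)%N - u (c * k + l)%N)
    + 2 * lam k * (psi l w - psi l (u (c * k + l)%N)).

Let Psi w := \sum_(1 <= l < c.+1) psi l w.

Variable z : V.
Hypothesis z_box : closed_box rho z.
Hypothesis z_min : forall w, closed_box rho w -> Psi z <= Psi w.

(** The midpoint of [z] and [w] competes with [z], and the quadratic part of
    [Psi] is strongly convex. *)
Lemma quadratic_growth w : closed_box rho w ->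
  4^-1 * sqnorm (w - z) <= Psi w - Psi z.
Proof.
move=> wr; have half01 : 0 <= (2^-1 : R) <= 1 by apply/andP; split; lra.
have := z_min (closed_box_segment z_box wr half01).
rewrite /Psi !(big_nat_recl c 1) //= !psi1 sqnorm_segment.
pose rest v := \sum_(1 <= l < c) psi l.+1 v.
have rest_tame : tame r rest by apply: tame_sum => l; exact: psi_tame.
have := tame_convex rest_tame z w half01.
rewrite /rest; lra.
Qed.

Lemma common_lipschitz : exists2 K, 0 <= K & forall l v w,
  (1 <= l <= c)%N -> box r v -> box r w ->
  (psi l v - psi l w) ^+ 2 <= K * sqnorm (v - w).
Proof.
have : forall l, exists K, 0 <= K /\ forall v w, box r v -> box r w ->
    (psi l v - psi l w) ^+ 2 <= K * sqnorm (v - w).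
  by move=> l; have [K] := tame_lipschitz (psi_tame l); exists K.
case/choice => K Kp; exists (\sum_(l < c.+1) K l) => [|l v w /andP[_ lc] vr wr].
  by apply: sumr_ge0 => l _; case: (Kp l).
have [_ /(_ v w vr wr)] := Kp l; move/le_trans; apply.
rewrite ler_wpM2r ?sqnorm_ge0 //.
rewrite (bigD1 (inord l)) //= inordK // lerDl sumr_ge0 // => i _.
by case: (Kp i).
Qed.

(** Within one cycle all summands may be evaluated at its first iterate, at the
    price of an error of second order in the step size. *)
Lemma cycle_descent : exists2 C, 0 <= C & forall k,
  sqnorm (u (c * k.+1)%N - z) <=
    sqnorm (u (c * k)%N - z) - 2 * lam k * (Psi (u (c * k)%N) - Psi z)
    + C * lam k ^+ 2.
Proof.
have [K K0 lip] := common_lipschitz.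
have ur n : box r (u n) by exact: closed_box_box (u_box n).
have zr : box r z by exact: closed_box_box z_box.
exists (2 * (c%:R * (2 ^+ c * K))) => [|k].
  by rewrite !mulr_ge0 ?exprn_ge0.
have move1 l : (1 <= l <= c)%N ->
    sqnorm (u (c * k + l)%N - u (c * k + l.-1)%N) <= lam k ^+ 2 * K.
  move=> lc; have := u_step k lc (ur (c * k + l.-1)%N).
  rewrite subrr sqnorm0 (sqnormBC (u (c * k + l.-1)%N)).
  have := lip l _ _ lc (ur (c * k + l.-1)%N) (ur (c * k + l)%N).
  rewrite (sqnormBC (u (c * k + l.-1)%N)).
  set D := sqnorm _; set P := psi l _ - _ => Plip Dle.
  have D0 : 0 <= D by exact: sqnorm_ge0.
  have l0 := lam_gt0 k.
  have [->|Dn0] := eqVneq D 0; first by rewrite mulr_ge0 ?sqr_ge0.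
  have Dp : 0 < D by rewrite lt_neqAle eq_sym Dn0.
  rewrite -(ler_pM2l Dp); have : D ^+ 2 <= (lam k * P) ^+ 2.
    by rewrite lerXn2r ?nnegrE //; lra.
  have := ler_wpM2l (sqr_ge0 (lam k)) Plip; rewrite exprMn; lra.
have moves l : (l <= c)%N ->
    sqnorm (u (c * k)%N - u (c * k + l)%N) <= 4 ^+ l * (lam k ^+ 2 * K).
  have lK0 : 0 <= lam k ^+ 2 * K by rewrite mulr_ge0 ?sqr_ge0.
  elim: l => [|l IH] lc; first by rewrite addn0 subrr sqnorm0 expr0 mul1r.
  have := move1 l.+1; rewrite ltnS leq0n lc => /(_ isT) /= m1.
  have := sqnormD_le (u (c * k)%N - u (c * k + l)%N)
    (u (c * k + l)%N - u (c * k + l.+1)%N).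
  rewrite addrA subrK (sqnormBC (u (c * k + l)%N)) => h.
  have := ler_peMl lK0 (exprn_ege1 l (ler1n R 4)).
  have := IH (ltnW lc); rewrite (exprS 4 l) => *; lra.
have lag l : (1 <= l <= c)%N ->
    psi l (u (c * k)%N) - psi l (u (c * k + l)%N) <= 2 ^+ c * K * lam k.
  move=> lc; have b0 : 0 <= 2 ^+ c * K * lam k.
    by rewrite !mulr_ge0 ?exprn_ge0 // ltW.
  apply: le_trans (ler_norm _) _; rewrite -(ler_pXn2r (n := 2)) ?nnegrE //.
  rewrite real_normK ?num_real //.
  apply: le_trans (lip l _ _ lc (ur _) (ur _)) _.
  apply: le_trans (ler_wpM2l K0 (moves l _)) _; first by case/andP: lc.
  have -> : (2 ^+ c * K * lam k) ^+ 2 = K * (4 ^+ c * (lam k ^+ 2 * K)).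
    have -> : 4 = 2 ^+ 2 :> R by ring.
    by rewrite exprAC; ring.
  rewrite ler_wpM2l // ler_wpM2r ?(mulr_ge0 (sqr_ge0 _)) //.
  by rewrite ler_weXn2l ?ler1n //; case/andP: lc.
have tele l : (l <= c)%N -> sqnorm (u (c * k + l)%N - z) <=
    sqnorm (u (c * k)%N - z)
    + 2 * lam k * \sum_(1 <= j < l.+1) (psi j z - psi j (u (c * k + j)%N)).
  elim: l => [|l IH] lc; first by rewrite addn0 big_geq // mulr0 addr0.
  have lc' : (1 <= l.+1 <= c)%N by rewrite lc.
  have := u_step k lc' zr; rewrite /= big_nat_recr //=.
  have := sqnorm_ge0 (u (c * k + l)%N - u (c * k + l.+1)%N).
  by have := IH (ltnW lc); lra.
rewrite mulnS addnC; apply: le_trans (tele c (leqnn c)) _.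
have sum_le : \sum_(1 <= j < c.+1) (psi j z - psi j (u (c * k + j)%N)) <=
    Psi z - Psi (u (c * k)%N) + c%:R * (2 ^+ c * K * lam k).
  have -> : c%:R * (2 ^+ c * K * lam k) =
      \sum_(1 <= j < c.+1) (2 ^+ c * K * lam k).
    by rewrite big_const_nat subSS subn0 iter_addr addr0 mulr_natl.
  rewrite /Psi -sumrB -big_split /= big_nat_cond [leRHS]big_nat_cond.
  apply: ler_sum => j /andP[jc _]; have := lag j jc; lra.
have := ler_wpM2l (ltW (lam_gt0 k)) sum_le; lra.
Qed.

Lemma cyclic_prox_cvg :
  series lam @ \oo --> +oo -> cvgn (series (fun k => lam k ^+ 2)) ->
  sqnorm (u (c * k)%N - z) @[k --> \oo] --> 0.
Proof.
move=> lam_div sq_cvg; have [C C0 desc] := cycle_descent.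
apply: (cvg0_of_contraction _ lam_gt0 C0 lam_div sq_cvg) => k.
  exact: sqnorm_ge0.
have := ler_wpM2l (ltW (lam_gt0 k)) (quadratic_growth (u_box (c * k)%N)).
have := desc k; lra.
Qed.

End Convergence.

(** * Lifting functionals to displacement fields *)

Section Lift.
Context {R : realType} {N M : nat}.
Local Notation V := 'M[R]_(N, M).
Variables (q : circle R) (f : grid R N M).
Implicit Types (u v w : V) (x y g : grid R N M) (phi : grid R N M -> R)
  (i k : 'I_N) (j : 'I_M).

Definition displace u : grid R N M := \matrix_(i, j) circle_exp (f i j) (u i j).
Definition displacement x : V := \matrix_(i, j) circle_log (f i j) (x i j).

Lemma displacementK x : displace (displacement x) = x.
Proof. by apply/matrixP => i j; rewrite !mxE circle_logK. Qed.

Lemma displace0 : displace 0 = f.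
Proof. by apply/matrixP => i j; rewrite !mxE circle_exp0. Qed.

(** Displacements below [3 pi / 16], added to neighbor distances below
    [pi / 8], keep neighboring pixels less than a quarter turn apart. *)
Definition lift_radius : R := 3 * pi / 16.

(** Nonnegativity is required on all grids because it bounds the length of a
    proximal step before its result is known to be close to [f]. *)
Definition lifts phi (psi : V -> R) : Prop :=
  [/\ forall x, 0 <= phi x, tame lift_radius psi &
      forall u, box lift_radius u -> phi (displace u) = psi u].

Definition liftable phi : Prop := exists psi, lifts phi psi.

Lemma liftable0 : liftable (fun=> 0).
Proof. by exists (fun=> 0); split=> //; exact: tame0. Qed.

Lemma liftableD phi phi' : liftable phi -> liftable phi' ->
  liftable (fun x => phi x + phi' x).
Proof.
move=> [psi [p0 pt pE]] [psi' [p0' pt' pE']]; exists (fun u => psi u + psi' u).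
split=> [x||u ur]; [by rewrite addr_ge0|exact: tameD|by rewrite pE ?pE'].
Qed.

Lemma liftableZ a phi : 0 <= a -> liftable phi -> liftable (fun x => a * phi x).
Proof.
move=> a0 [psi [p0 pt pE]]; exists (fun u => a * psi u).
split=> [x||u ur]; [by rewrite mulr_ge0|exact: tameZ|by rewrite pE].
Qed.

Lemma liftable_sum (I : Type) (s : seq I) (P : pred I)
    (F : I -> grid R N M -> R) :
  (forall i : I, P i -> liftable (F i)) ->
  liftable (fun x => \sum_(i <- s | P i) F i x).
Proof.
move=> Fl; elim: s => [|i s IH].
  by under eq_fun do rewrite big_nil; exact: liftable0.
under eq_fun do rewrite big_cons.
by have [Pi|_] := boolP (P i); [apply: liftableD => //; exact: Fl|exact: IH].
Qed.

Lemma lifts_fidelity : lifts (fidelity f) (fun u => 2^-1 * sqnorm u).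
Proof.
have pi0 := pi_gt0 R; split => [x||u ur].
- rewrite mulr_ge0 // sumr_ge0 // => i _; rewrite sumr_ge0 // => j _.
  exact: sqr_ge0.
- exact: tame_half_sqnorm.
rewrite /fidelity sqnormE; congr (_ * _).
apply: eq_bigr => i _; apply: eq_bigr => j _; rewrite mxE.
rewrite -{1}(circle_exp0 (f i j)) gdist_exp subr0.
rewrite (norm_wrapE (angle_eqxx _)) ?real_normK ?num_real //.
by apply: lt_trans (ur i j) _; rewrite /lift_radius; lra.
Qed.

Lemma fidelity_displacement x : fidelity f x = 2^-1 * sqnorm (displacement x).
Proof.
rewrite /fidelity sqnormE; congr (_ * _).
apply: eq_bigr => i _; apply: eq_bigr => j _; rewrite mxE.
have [log_bounds logE] := circle_logP (f i j) (x i j).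
rewrite -{1}(circle_exp0 (f i j)) -{1}logE gdist_exp subr0.
by rewrite (wrap_uniq (angle_eqxx _) log_bounds) real_normK ?num_real.
Qed.

(** * Differences between neighboring pixels *)

Lemma gdist_log (p p' : circle R) :
  gdist p p' = `|wrap (circle_log q p' - circle_log q p)|.
Proof. by rewrite -(gdist_exp q) !circle_logK. Qed.

(** A common lift of three consecutive points has second difference
    [a + b]. *)
Lemma d2_edges (p1 p2 p3 : circle R) a b :
  angle_eq (circle_log q p1 - circle_log q p2) a ->
  angle_eq (circle_log q p3 - circle_log q p2) b ->
  `|a| < pi / 2 -> `|b| < pi / 2 -> d2 q p1 p2 p3 = `|a + b|.
Proof.
rewrite !ltr_norml => pa pb /andP[la ua] /andP[lb ub].
have pi0 := pi_gt0 R; set t := circle_log q p2 in pa pb.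
pose eta : 'rV[R]_3 := \row_(i < 3) [:: t + a; t; t + b]`_i.
have sumE : \sum_i eta 0 i * b2 0 i = a + b.
  by rewrite !big_ord_recl big_ord0 !mxE /=; ring.
rewrite /d2 -sumE; apply: (@cyclic_diff_arc _ _ _ _ _ (@Ordinal 3 1 isT)).
- by case=> [[|[|[|]]]] //= ?; rewrite !mxE /=;
    [exact: angle_eq_turn|exact: angle_eqxx|exact: angle_eq_turn].
- case=> [[|[|[|]]]] //= ?; rewrite !mxE /= ltr_norml;
    by apply/andP; split; lra.
- case=> [[|[|[|]]]] //= ?; rewrite !mxE /=; [by exists 1| |by exists 1].
  by exists (- 2); rewrite intrN.
- by rewrite !big_ord_recl big_ord0 !mxE /=; ring.
- by rewrite sumE ltr_norml; apply/andP; split; lra.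
Qed.

(** Lifting the four corners of a unit square along the path [p2], [p1], [p3],
    [p4] leaves only the edges from [p1] to [p2] and from [p3] to [p4] in the
    mixed difference. *)
Lemma d11_edges (p1 p2 p3 p4 : circle R) a b e :
  angle_eq (circle_log q p2 - circle_log q p1) a ->
  angle_eq (circle_log q p3 - circle_log q p1) e ->
  angle_eq (circle_log q p4 - circle_log q p3) b ->
  `|a| < pi / 2 -> `|e| < pi / 2 -> `|b| < pi / 2 ->
  d11 q p1 p2 p3 p4 = `|a - b|.
Proof.
rewrite !ltr_norml => pa pe pb /andP[la ua] /andP[le ue] /andP[lb ub].
have pi0 := pi_gt0 R; set t := circle_log q p1 in pa pe pb.
pose eta : 'rV[R]_4 := \row_(i < 4) [:: t; t + a; t + e; t + (e + b)]`_i.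
have sumE : \sum_i eta 0 i * b11 0 i = a - b.
  by rewrite !big_ord_recl big_ord0 !mxE /=; ring.
rewrite /d11 -sumE; apply: (@cyclic_diff_arc _ _ _ _ _ (@Ordinal 4 0 isT)).
- case=> [[|[|[|[|]]]]] //= ?; rewrite !mxE /=;
    [exact: angle_eqxx|exact: angle_eq_turn|exact: angle_eq_turn|];
    apply: angle_eq_turn.
  by have := angle_eqD pe pb; rewrite addrC addrA subrK.
- case=> [[|[|[|[|]]]]] //= ?; rewrite !mxE /= ltr_norml;
    by apply/andP; split; lra.
- case=> [[|[|[|[|]]]]] //= ?; rewrite !mxE /=; [|by exists 1|by exists 1|];
    by exists (- 1); rewrite intrN.
- by rewrite !big_ord_recl big_ord0 !mxE /=; ring.
- by rewrite sumE ltr_norml; apply/andP; split; lra.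
Qed.

Lemma cyclic_diff_ge0 n (x w : 'rV[R]_n) : 0 <= cyclic_diff x w.
Proof.
rewrite /cyclic_diff; set S := mkset _.
have [->|S0] := eqVneq S set0; first by rewrite inf0.
by apply: lb_le_inf; [exact/set0P|move=> _ [a [y _ ->]]].
Qed.

Hypothesis f_near : dinfty f < pi / 8.

Lemma gdist_neighbor i j k (l : 'I_M) :
  (`|i%:Z - k%:Z| + `|j%:Z - l%:Z| == 1)%R ->
  gdist (f i j) (f k l) < pi / 8.
Proof.
move=> nb; apply: le_lt_trans f_near; rewrite /dinfty.
apply: le_trans (le_bigmax_cond _ _ (isT : xpredT i)).
apply: le_trans (le_bigmax_cond _ _ (isT : xpredT j)).
apply: le_trans (le_bigmax_cond _ _ (isT : xpredT k)).
exact: (le_bigmax_cond _ (fun l => gdist (f i j) (f k l)) nb).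
Qed.

(** The angle from a pixel to its neighbor, followed continuously from [f]. *)
Lemma edge_angle i j k (l : 'I_M) : (`|i%:Z - k%:Z| + `|j%:Z - l%:Z| == 1)%R ->
  exists2 a : V -> R, affine a & forall u, box lift_radius u ->
    `|a u| < pi / 2 /\
    angle_eq (circle_log q (displace u k l) - circle_log q (displace u i j))
      (a u).
Proof.
move=> nb; pose t i j := circle_log q (f i j).
exists (fun u => wrap (t k l - t i j) + (u k l - u i j)).
  apply: affineD; first exact: affine_cst.
  by apply: affineD; [|apply: affineN]; exact: affine_entry.
move=> u ur; split.
  have := gdist_neighbor nb; rewrite gdist_log -!/(t _ _) => h.
  apply: le_lt_trans (ler_normD _ _) _.
  have := ler_normB (u k l) (u i j); have := ur i j; have := ur k l.
  by rewrite /lift_radius; lra.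
have log_displace m n :
    angle_eq (circle_log q (displace u m n)) (t m n + u m n).
  by rewrite mxE -{1}(circle_logK q (f m n)) circle_expD; exact: circle_log_exp.
apply: angle_eq_trans (angle_eqB (log_displace k l) (log_displace i j)) _.
rewrite (_ : _ - _ = (t k l - t i j) + (u k l - u i j)); last by ring.
by apply: angle_eqD; [exact: angle_eq_wrap|exact: angle_eqxx].
Qed.

Lemma liftable_gdist i j k (l : 'I_M) :
  (`|i%:Z - k%:Z| + `|j%:Z - l%:Z| == 1)%R ->
  liftable (fun x => gdist (x i j) (x k l)).
Proof.
move=> /edge_angle[a a_aff aE]; exists (fun u => `|a u|).
split=> [x||u ur]; [by rewrite gdist_log|exact: tame_norm_affine|].
have [a_small a_angle] := aE u ur; rewrite gdist_log (norm_wrapE a_angle) //.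
by have := pi_gt0 R; lra.
Qed.

Lemma liftable_d2 (i1 i2 i3 : 'I_N) (j1 j2 j3 : 'I_M) :
  (`|i2%:Z - i1%:Z| + `|j2%:Z - j1%:Z| == 1)%R ->
  (`|i2%:Z - i3%:Z| + `|j2%:Z - j3%:Z| == 1)%R ->
  liftable (fun x => d2 q (x i1 j1) (x i2 j2) (x i3 j3)).
Proof.
move=> /edge_angle[a a_aff aE] /edge_angle[b b_aff bE].
exists (fun u => `|a u + b u|); split=> [x||u ur].
- exact: cyclic_diff_ge0.
- by apply: tame_norm_affine; exact: affineD.
- by have [? ?] := aE u ur; have [? ?] := bE u ur; exact: d2_edges.
Qed.

Lemma liftable_d11 (i1 i2 i3 i4 : 'I_N) (j1 j2 j3 j4 : 'I_M) :
  (`|i1%:Z - i2%:Z| + `|j1%:Z - j2%:Z| == 1)%R ->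
  (`|i1%:Z - i3%:Z| + `|j1%:Z - j3%:Z| == 1)%R ->
  (`|i3%:Z - i4%:Z| + `|j3%:Z - j4%:Z| == 1)%R ->
  liftable (fun x => d11 q (x i1 j1) (x i2 j2) (x i3 j3) (x i4 j4)).
Proof.
move=> /edge_angle[a a_aff aE] /edge_angle[e e_aff eE] /edge_angle[b b_aff bE].
exists (fun u => `|a u - b u|); split=> [x||u ur].
- exact: cyclic_diff_ge0.
- by apply: tame_norm_affine; apply: affineD => //; exact: affineN.
- have [? ?] := aE u ur; have [? ?] := bE u ur; have [? ?] := eE u ur.
  exact: (d11_edges (e := e u)).
Qed.

Lemma neighbor_succ (i j i' : nat) : i' = i.+1 ->
  [/\ (`|i%:Z - i'%:Z| + `|j%:Z - j%:Z| == 1)%R,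
      (`|i'%:Z - i%:Z| + `|j%:Z - j%:Z| == 1)%R,
      (`|j%:Z - j%:Z| + `|i%:Z - i'%:Z| == 1)%R &
      (`|j%:Z - j%:Z| + `|i'%:Z - i%:Z| == 1)%R].
Proof. by move=> ->; split; apply/eqP; lia. Qed.

Lemma liftable_tv1_ver P : liftable (tv1_ver P).
Proof.
apply: liftable_sum => i _; apply: liftable_sum => i1 /eqP ii1.
apply: liftable_sum => j _; apply: liftable_gdist.
by have [] := neighbor_succ j ii1.
Qed.

Lemma liftable_tv1_hor P : liftable (tv1_hor P).
Proof.
apply: liftable_sum => j _; apply: liftable_sum => j1 /eqP jj1.
apply: liftable_sum => i _; apply: liftable_gdist.
by have [] := neighbor_succ i jj1.
Qed.

Lemma liftable_tv2_ver P : liftable (tv2_ver q P).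
Proof.
apply: liftable_sum => i _; apply: liftable_sum => i1 /eqP ii1.
apply: liftable_sum => i2 /eqP ii2; apply: liftable_sum => j _.
have i12 : (i2 = i1.+1 :> nat) by rewrite ii2 ii1.
by apply: liftable_d2;
  [have [] := neighbor_succ j ii1|have [] := neighbor_succ j i12].
Qed.

Lemma liftable_tv2_hor P : liftable (tv2_hor q P).
Proof.
apply: liftable_sum => j _; apply: liftable_sum => j1 /eqP jj1.
apply: liftable_sum => j2 /eqP jj2; apply: liftable_sum => i _.
have j12 : (j2 = j1.+1 :> nat) by rewrite jj2 jj1.
by apply: liftable_d2;
  [have [] := neighbor_succ i jj1|have [] := neighbor_succ i j12].
Qed.

Lemma liftable_tv2_dia P Q : liftable (tv2_dia q P Q).
Proof.
apply: liftable_sum => i _; apply: liftable_sum => i1 /eqP ii1.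
apply: liftable_sum => j _; apply: liftable_sum => j1 /eqP jj1.
apply: liftable_d11; [by have [] := neighbor_succ j ii1| |].
  by have [] := neighbor_succ i jj1.
by have [] := neighbor_succ j1 ii1.
Qed.

Section Parts.
Variables (alpha beta : R * R) (gamma : R).
Hypothesis alpha_ge0 : 0 <= alpha.1 /\ 0 <= alpha.2.
Hypothesis beta_ge0 : 0 <= beta.1 /\ 0 <= beta.2.
Hypothesis gamma_ge0 : 0 <= gamma.

Lemma liftable_Jpart l : exists2 psi, lifts (Jpart q alpha beta gamma f l) psi &
  l = 1%N -> psi = fun u => 2^-1 * sqnorm u.
Proof.
have [[a1 a2] [g1 g2]] := (alpha_ge0, beta_ge0).
case: l => [|[|l]]; first by have [psi ?] := liftable0; exists psi.
  by exists (fun u => 2^-1 * sqnorm u) => //; exact: lifts_fidelity.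
suff [psi ?] : liftable (Jpart q alpha beta gamma f l.+2) by exists psi.
do 14! [case: l => [|l] /=; first by apply: liftableZ => //;
  first [exact: liftable_tv1_ver|exact: liftable_tv1_hor|exact: liftable_tv2_ver
        |exact: liftable_tv2_hor|exact: liftable_tv2_dia]].
exact: liftable0.
Qed.

End Parts.

(** * Proximal steps on the circle *)

(** The choice [w = 0] of the competitor shows that the step is short enough for
    its result to be lifted next to the previous iterate. *)
Lemma prox_displacement mu phi psi x x' :
  lifts phi psi -> 0 <= mu ->
  sqnorm (displacement x) + 2 * mu * psi 0 < (lift_radius / 2) ^+ 2 ->
  prox mu phi x x' ->
  let u := displacement x in let u' := displacement x' in
  box lift_radius u' /\ forall w, box lift_radius w ->
    sqnorm (u' - w) <=
      sqnorm (u - w) - sqnorm (u - u') + 2 * mu * (psi w - psi u').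
Proof.
move=> [phi0 psi_tame phiE] mu0 short x'min u u'.
have pi0 := pi_gt0 R; have r0 : 0 < lift_radius by rewrite /lift_radius; lra.
have psi00 : 0 <= mu * psi 0 by rewrite mulr_ge0 ?(tame_ge0 psi_tame).
have small v : sqnorm v < (lift_radius / 2) ^+ 2 ->
    forall i j, `|v i j| < lift_radius / 2.
  move=> v_small i j; rewrite -(ltr_pXn2r (n := 2)) ?nnegrE //; last by lra.
  by rewrite real_normK ?num_real // (le_lt_trans (sqr_entry_le v i j)).
have u_small : forall i j, `|u i j| < lift_radius / 2 by apply: small; lra.
(* Among the angles of [x'] relative to [f], those nearest to [u]. *)
pose v : V := \matrix_(i, j) (u i j - wrap (u i j - u' i j)).
have vE i j : angle_eq (v i j) (u' i j).
  rewrite mxE -[X in angle_eq _ X](subKr (u i j)).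
  apply: angle_eqB; first exact: angle_eqxx.
  exact: angle_eq_sym (angle_eq_wrap _).
have distE : \sum_i \sum_j gdist (x' i j) (x i j) ^+ 2 = sqnorm (v - u).
  rewrite sqnormE; apply: eq_bigr => i _; apply: eq_bigr => j _.
  rewrite !mxE addrAC subrr add0r sqrrN.
  rewrite -{1}(circle_logK (f i j) (x' i j)) -{1}(circle_logK (f i j) (x i j)).
  by rewrite gdist_exp real_normK ?num_real.
have x'le w : box lift_radius w ->
    2^-1 * sqnorm (v - u) + mu * phi x' <= 2^-1 * sqnorm (w - u) + mu * psi w.
  move=> wr; rewrite -distE; apply: le_trans (x'min (displace w)) _.
  rewrite (phiE _ wr) lerD2r ler_wpM2l // sqnormE.
  apply: ler_sum => i _; apply: ler_sum => j _; rewrite !mxE.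
  rewrite -{1}(circle_logK (f i j) (x i j)) -real_normK ?num_real //.
  rewrite -[leRHS]real_normK ?num_real // lerXn2r ?nnegrE //.
  rewrite gdist_exp normr_id (distrC (w i j)).
  by apply: norm_wrap_le; exact: angle_eqxx.
have v_short : sqnorm (v - u) < (lift_radius / 2) ^+ 2.
  have := x'le 0 (box0 r0); rewrite sub0r sqnormN.
  by have := mulr_ge0 mu0 (phi0 x'); rewrite -/u in short; lra.
have vu' : v = u'.
  apply/matrixP => i j; apply: angle_eq_small (vE i j) _.
  have := small _ v_short i j; have := u_small i j.
  have [/andP[l1 l2] _] := circle_logP (f i j) (x' i j).
  rewrite [u' i j]mxE (_ : (v - u) i j = v i j - u i j) ?mxE //.
  rewrite !ltr_norml /lift_radius => /andP[h1 h2] /andP[h3 h4].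
  by apply/andP; split; lra.
have u'r : box lift_radius u'.
  move=> i j; rewrite -vu'; have := small _ v_short i j; have := u_small i j.
  rewrite (_ : (v - u) i j = v i j - u i j) ?mxE // !ltr_norml.
  by move=> /andP[h1 h2] /andP[h3 h4]; apply/andP; split; lra.
split=> // w wr; apply: (prox_step_le psi_tame mu0 u'r wr) => w' w'r.
by have := x'le w' w'r; rewrite vu' -(phiE _ u'r) displacementK.
Qed.

End Lift.

(** * The iterates stay near the data *)

Section Iterates.
Context {R : realType} {N M : nat}.
Local Notation V := 'M[R]_(N, M).
Variables (f : grid R N M) (c : nat) (Jl : nat -> grid R N M -> R).
Variables (psi : nat -> V -> R) (lam : R^nat) (x : nat -> grid R N M) (eps : R).
Hypothesis psi_lifts : forall l, lifts f (Jl l) (psi l).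
Hypothesis psi1 : psi 1%N = fun u => 2^-1 * sqnorm u.
Hypothesis c_gt0 : (0 < c)%N.
Hypothesis lam_bounds : forall k, 0 < lam k <= 1 / 480.
Hypothesis eps_bounds : 0 <= eps < pi / 16.
Hypothesis psi_f : \sum_(1 <= l < c.+1) psi l 0 <= eps ^+ 2.
Hypothesis x_cppa : is_CPPA c Jl lam f x.

Let u n := displacement f (x n).
(* The factor [1 + 1 / 480] absorbs the second order in [lam k]. *)
Let bound := 2 * eps ^+ 2 * (1 + 1 / 480).

Lemma bound_lift_radius : bound < (lift_radius / 2) ^+ 2 :> R.
Proof.
have /andP[e0 /ltW e1] := eps_bounds.
have : eps ^+ 2 <= (pi / 16) ^+ 2.
  by rewrite lerXn2r // nnegrE; exact: le_trans e1.
by have := exprn_gt0 2 (pi_gt0 R); rewrite /bound /lift_radius; lra.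
Qed.

Lemma bound_half_radius : bound <= (pi / 8) ^+ 2 :> R.
Proof.
have /andP[e0 /ltW e1] := eps_bounds.
have : eps ^+ 2 <= (pi / 16) ^+ 2.
  by rewrite lerXn2r // nnegrE; exact: le_trans e1.
by have := exprn_gt0 2 (pi_gt0 R); rewrite /bound; lra.
Qed.

(** The contraction by the fidelity outweighs all that the rest of a cycle adds
    once the squared norm has reached [bound]. *)
Lemma bound_contraction k :
  bound / (1 + lam k) + 2 * lam k * eps ^+ 2 <= bound.
Proof.
have /andP[l0 l1] := lam_bounds k; have lam1 : 0 < 1 + lam k by lra.
rewrite -lerBrDr ler_pdivrMr // /bound; have := sqr_ge0 eps; nra.
Qed.

Lemma psi_ge0 l v : 0 <= psi l v.
Proof. by case: (psi_lifts l) => _ /tame_ge0 ->. Qed.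

Lemma partial_psi_f l : (l <= c)%N -> \sum_(1 <= j < l.+1) psi j 0 <= eps ^+ 2.
Proof.
move=> lc; apply: le_trans psi_f.
rewrite [leRHS](big_cat_nat (n := l.+1)) //= lerDl.
by apply: sumr_ge0 => j _; exact: psi_ge0.
Qed.

(** Each step is tested against the data: the fidelity contracts towards them by
    the factor [1 + lam k], and a later step [l] adds at most
    [2 * lam k * psi l 0], because [psi l] is nonnegative. *)
Lemma cycle_bound k l : sqnorm (u (c * k)%N) <= bound -> (1 <= l <= c)%N ->
  sqnorm (u (c * k + l)%N) <=
    bound / (1 + lam k) + 2 * lam k * \sum_(1 <= j < l.+1) psi j 0.
Proof.
have /andP[l0 l1] := lam_bounds k => start.
have lam1 : 0 < 1 + lam k by lra.
have r0 : box lift_radius (0 : V).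
  by apply: box0; rewrite /lift_radius; have := pi_gt0 R; lra.
elim: l => // l IH /andP[_ lc].
have [_ prox_x] := x_cppa.
have /prox_x /= : (1 <= l.+1 <= c)%N by rewrite lc.
move=> /(_ k)/(prox_displacement (psi_lifts l.+1) (ltW l0)) step.
have := bound_lift_radius.
case: l IH lc step => [|l] IH lc step below.
  have psi10 : psi 1%N 0 = 0 by rewrite psi1 sqnorm0 mulr0.
  move: step; rewrite addn0 psi10 mulr0 addr0 => step.
  have [|_ /(_ 0 r0)] := step; first exact: le_lt_trans start below.
  rewrite big_nat1 psi10 mulr0 addr0 psi1 -/(u _) -/(u _) !subr0 => le0.
  rewrite ler_pdivlMr //; have := sqnorm_ge0 (u (c * k)%N - u (c * k + 1)%N).
  lra.
have := IH (ltnW lc); have := partial_psi_f lc; rewrite big_nat_recr //=.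
set s := \sum_(_ <= _ < _) _ => sum_le ul.
have contraction := bound_contraction k.
have sum_le' := ler_wpM2l (ltW l0) sum_le.
have [|_ /(_ 0 r0)] := step; first by rewrite -/(u _); lra.
rewrite -/(u _) -/(u _) !subr0.
have := mulr_ge0 (ltW l0) (psi_ge0 l.+2 (u (c * k + l.+2)%N)).
have := sqnorm_ge0 (u (c * k + l.+1)%N - u (c * k + l.+2)%N); lra.
Qed.

Lemma start_bound k : sqnorm (u (c * k)%N) <= bound.
Proof.
elim: k => [|k IH].
  have -> : u (c * 0)%N = 0.
    rewrite muln0 /u (proj1 x_cppa); apply/matrixP => i j; rewrite !mxE.
    apply: angle_eq_small; last first.
      have [/andP[h1 h2] _] := circle_logP (f i j) (f i j).
      have pi0 := pi_gt0 R.
      by rewrite subr0 ltr_norml; apply/andP; split; lra.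
    by apply: (@circle_exp_inj _ (f i j)); rewrite circle_logK circle_exp0.
  by rewrite sqnorm0 /bound; have := sqr_ge0 eps; lra.
rewrite mulnS addnC; apply: le_trans (cycle_bound IH _) _.
  by rewrite c_gt0 leqnn.
have /andP[l0 _] := lam_bounds k.
by have := ler_wpM2l (ltW l0) psi_f; have := bound_contraction k; lra.
Qed.

Lemma iterate_bound n : sqnorm (u n) <= bound.
Proof.
rewrite (divn_eq n c) mulnC; set k := (n %/ c)%N.
have := ltn_pmod n c_gt0; case: (n %% c)%N => [|l] lc.
  by rewrite addn0; exact: start_bound.
have lc' : (1 <= l.+1 <= c)%N by rewrite (ltnW lc).
apply: le_trans (cycle_bound (start_bound k) lc') _.
have /andP[l0 _] := lam_bounds k.
have := ler_wpM2l (ltW l0) (partial_psi_f (ltnW lc)).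
have := bound_contraction k; lra.
Qed.

Lemma iterate_closed_box n : closed_box (pi / 8) (u n).
Proof.
apply: sqnorm_closed_box; first by rewrite divr_ge0 ?pi_ge0.
exact: le_trans (iterate_bound n) bound_half_radius.
Qed.

Lemma iterate_step k l w : (1 <= l <= c)%N -> box lift_radius w ->
  sqnorm (u (c * k + l)%N - w) <= sqnorm (u (c * k + l.-1)%N - w)
    - sqnorm (u (c * k + l.-1)%N - u (c * k + l)%N)
    + 2 * lam k * (psi l w - psi l (u (c * k + l)%N)).
Proof.
move=> lc wr; have /andP[l0 l1] := lam_bounds k; have [_ prox_x] := x_cppa.
have [|_] := prox_displacement (psi_lifts l) (ltW l0) _ (prox_x k l lc);
  last exact.
apply: le_lt_trans bound_lift_radius; rewrite -/(u _).
case: l lc => [//|[|l]] /= lc.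
  by rewrite psi1 sqnorm0 !mulr0 addr0; exact: iterate_bound.
have lc' : (1 <= l.+1 <= c)%N by exact: ltnW lc.
apply: le_trans (bound_contraction k).
have := cycle_bound (start_bound k) lc'.
have := partial_psi_f lc; rewrite big_nat_recr //=.
by set s := \sum_(_ <= _ < _) _ => /(ler_wpM2l (ltW l0)); lra.
Qed.

End Iterates.

(** * Convergence to a global minimizer *)

Section Minimizer.
Context {R : realType} {N M : nat}.
Variables (q : circle R) (alpha beta : R * R) (gamma : R) (f : grid R N M).
Hypothesis alpha_ge0 : 0 <= alpha.1 /\ 0 <= alpha.2.
Hypothesis beta_ge0 : 0 <= beta.1 /\ 0 <= beta.2.
Hypothesis gamma_ge0 : 0 <= gamma.
Hypothesis f_near : dinfty f < pi / 8.

Lemma J_data_le m e :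
  m = Num.max alpha.1
       (Num.max alpha.2 (Num.max beta.1 (Num.max beta.2 gamma))) ->
  ~ (alpha = (0, 0) /\ beta = (0, 0) /\ gamma = 0) ->
  TV1 (1, 1) f + TV2hv q (1, 1) f + TV2d q 1 f <= e / m ->
  J q alpha beta gamma f f <= e.
Proof.
move=> mE not0; have [[a1 a2] [g1 g2]] := (alpha_ge0, beta_ge0).
have [am1 [am2 [bm1 [bm2 gm]]]] : alpha.1 <= m /\ alpha.2 <= m /\ beta.1 <= m /\
    beta.2 <= m /\ gamma <= m by rewrite mE !le_max !lexx !orbT.
have m_gt0 : 0 < m.
  rewrite lt_neqAle (le_trans a1 am1) andbT; apply/eqP => m0; apply: not0.
  rewrite -m0 in am1 am2 bm1 bm2 gm.
  split; [|split]; last by apply/le_anti/andP.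
    by rewrite [alpha]surjective_pairing; congr (_, _); apply/le_anti/andP.
  by rewrite [beta]surjective_pairing; congr (_, _); apply/le_anti/andP.
rewrite ler_pdivlMr // /J /TV1 /TV2hv /TV2d /= !mul1r => tv_le.
have tv_ge0 phi : liftable f phi -> 0 <= phi f by move=> [psi []].
have := tv_ge0 _ (liftable_tv1_ver q f_near predT).
have := tv_ge0 _ (liftable_tv1_hor q f_near predT).
have := tv_ge0 _ (liftable_tv2_ver q f_near predT).
have := tv_ge0 _ (liftable_tv2_hor q f_near predT).
have := tv_ge0 _ (liftable_tv2_dia q f_near predT predT).
move=> t1 t2 t3 t4 t5.
have -> : fidelity f f = 0.
  have [_ _ fidE] := lifts_fidelity f; have := fidE 0.
  rewrite displace0 sqnorm0 mulr0; apply; apply: box0.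
  by rewrite /lift_radius; have := pi_gt0 R; lra.
nra.
Qed.

(** Grids that beat the data have fidelity at most [eps ^+ 2]; hence they lie
    in the coordinate box where [z] is minimal. *)
Lemma lifted_minimizer psi eps z :
  (forall l, lifts f (Jpart q alpha beta gamma f l) (psi l)) ->
  0 <= eps < pi / 16 -> J q alpha beta gamma f f <= eps ^+ 2 ->
  closed_box (pi / 8) z ->
  (forall w, closed_box (pi / 8) w ->
    \sum_(1 <= l < 16) psi l z <= \sum_(1 <= l < 16) psi l w) ->
  argmin (J q alpha beta gamma f) (displace f z).
Proof.
move=> psi_lifts /andP[e0 /ltW e1] Jf zr z_min y.
have pi0 := pi_gt0 R.
have J_lift w : closed_box (pi / 8) w ->
    J q alpha beta gamma f (displace f w) = \sum_(1 <= l < 16) psi l w.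
  move=> wr; rewrite J_split; apply: eq_bigr => l _.
  have [_ _ ->] := psi_lifts l => //; apply: closed_box_box wr.
  by rewrite /lift_radius; lra.
rewrite (J_lift _ zr).
have [Jy|/ltW Jy] := leP (J q alpha beta gamma f y) (eps ^+ 2); last first.
  apply: le_trans Jy; apply: le_trans Jf; rewrite -{2}(displace0 f) J_lift.
    by apply: z_min; apply: closed_box0; lra.
  by apply: closed_box0; lra.
have fid_le : fidelity f y <= eps ^+ 2.
  apply: le_trans Jy; rewrite J_split big_nat_recl //= lerDl.
  by apply: sumr_ge0 => l _; have [Jl0 _ _] := psi_lifts l.+1; exact: Jl0.
suff yr : closed_box (pi / 8) (displacement f y).
  by rewrite -(displacementK f y) J_lift //; exact: z_min.
apply: sqnorm_closed_box; first by lra.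
rewrite fidelity_displacement in fid_le.
have : eps ^+ 2 <= (pi / 16) ^+ 2.
  by rewrite lerXn2r // nnegrE; exact: le_trans e1.
by have := exprn_gt0 2 pi0; lra.
Qed.

End Minimizer.

Lemma grid_cvg_displace (R : realType) (N M : nat) (f : grid R N M)
    (x : nat -> grid R N M) (z : 'M[R]_(N, M)) :
  sqnorm (displacement f (x n) - z) @[n --> \oo] --> 0 ->
  grid_cvg x (displace f z).
Proof.
move=> cvg_z i j; apply/cvgr0Pnorm_le => e e0.
have e20 : 0 < e ^+ 2 by exact: exprn_gt0.
move/cvgr0Pnorm_le: cvg_z => /(_ _ e20) cvg_z; near=> n.
have le_e : sqnorm (displacement f (x n) - z) <= e ^+ 2.
  by rewrite -(ger0_norm (sqnorm_ge0 _)); near: n.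
rewrite -{1}(circle_logK (f i j) (x n i j)) mxE gdist_exp normr_id.
apply: le_trans (norm_wrap_le (angle_eqxx _)) _.
rewrite -(ler_pXn2r (n := 2)) ?nnegrE ?(ltW e0) // real_normK ?num_real //.
apply: le_trans le_e; have := sqr_entry_le (displacement f (x n) - z) i j.
by rewrite !mxE -sqrrN opprB.
Unshelve. all: by end_near. Qed.

Lemma small_steps (R : realType) (lam : R^nat) (eps : R) :
  (forall k, 0 < lam k) -> cvgn (series (fun k => lam k ^+ 2)) -> 0 < eps ->
  Num.sqrt (eps ^+ 2 + 2 * l2norm lam ^+ 2 * 4 ^+ 2 * 15%:R * (15%:R + 1))
    + 2 * linfnorm lam * 15%:R * 4 < pi / 16 ->
  0 <= eps < pi / 16 /\ forall k, 0 < lam k <= 1 / 480.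
Proof.
move=> lam0 sq_cvg e0; set X := 2 * l2norm lam ^+ 2 * _ * _ * _ => small.
have eX : eps <= Num.sqrt (eps ^+ 2 + X).
  rewrite -{1}(ger0_norm (ltW e0)) -sqrtr_sqr ler_wsqrtr // lerDl /X.
  by have := sqr_ge0 (l2norm lam); lra.
have lam_sup k : lam k <= linfnorm lam.
  rewrite -(ger0_norm (ltW (lam0 k))).
  apply: ub_le_sup; last by exists k.
  (* By [t <= 1 + t ^+ 2], a bound on the squares bounds the steps. *)
  exists (1 + limn (series (fun k => lam k ^+ 2))) => _ [n _ <-].
  have S_nd : nondecreasing_seq (series (fun k => lam k ^+ 2)).
    by apply: nondecreasing_series => *; exact: sqr_ge0.
  have := nondecreasing_cvgn_le S_nd sq_cvg n.+1.
  rewrite /series /= big_nat_recr //= => le_lim.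
  have : 0 <= \sum_(0 <= i < n) lam i ^+ 2.
    by apply: sumr_ge0 => *; exact: sqr_ge0.
  rewrite (ger0_norm (ltW (lam0 n))); have := sqr_ge0 (lam n - 1); nra.
have sup0 : 0 < linfnorm lam by exact: lt_le_trans (lam0 0%N) (lam_sup 0%N).
(* [120 * lam k < pi / 16] and [pi < 4] give [lam k < 1 / 480]. *)
have pi4 := pihalf_lt2 R.
split=> [|k]; first by rewrite ltW //=; lra.
by rewrite lam0 /=; have := lam_sup k; lra.
Qed.

Unset Implicit Arguments.

Theorem theorem4p10 (R : realType) (N M : nat) (q : circle R)
    (alpha beta : R * R) (gamma : R) (f : grid R N M)
    (lambda : nat -> R) (c : nat) (eps L m : R) (x : nat -> grid R N M)
    (alpha_ge0 : 0 <= alpha.1 /\ 0 <= alpha.2)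
    (beta_ge0 : 0 <= beta.1 /\ 0 <= beta.2)
    (gamma_ge0 : 0 <= gamma)
    (not_all_zero : ~ (alpha = (0, 0) /\ beta = (0, 0) /\ gamma = 0))
    (f_near : dinfty f < pi / 8)
    (lambda_gt0 : forall k, 0 < lambda k)
    (lambda_sum : series lambda @ \oo --> +oo)
    (lambda_sqr_sum : cvgn (series (fun k => lambda k ^+ 2)))
    (c_eq : c = 15%N) (L_eq : L = 4)
    (eps_gt0 : 0 < eps)
    (lambda_small :
      Num.sqrt (eps ^+ 2 + 2 * l2norm lambda ^+ 2 * L ^+ 2 * c%:R * (c%:R + 1))
        + 2 * linfnorm lambda * c%:R * L < pi / 16)
    (m_eq : m = Num.max alpha.1
                 (Num.max alpha.2 (Num.max beta.1 (Num.max beta.2 gamma))))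
    (tv_small :
      TV1 (1, 1) f + TV2hv q (1, 1) f + TV2d q 1 f <= eps ^+ 2 / m)
    (x_cppa : is_CPPA c (Jpart q alpha beta gamma f) lambda f x) :
  exists2 xs : grid R N M,
    argmin (J q alpha beta gamma f) xs &
    grid_cvg (fun k => x (c * k)%N) xs.
Proof.
subst c L; have pi0 := pi_gt0 R.
have [eps_bounds lam_bounds] :=
  small_steps lambda_gt0 lambda_sqr_sum eps_gt0 lambda_small.
have Jf := J_data_le alpha_ge0 beta_ge0 gamma_ge0 f_near m_eq not_all_zero
  tv_small.
have /choice[psi psi_spec] : forall l, exists psi,
    lifts f (Jpart q alpha beta gamma f l) psi /\
    (l = 1%N -> psi = fun u => 2^-1 * sqnorm u).
  move=> l.
  have [psi] := liftable_Jpart q f_near alpha_ge0 beta_ge0 gamma_ge0 l.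
  by exists psi.
have psi_lifts l := (psi_spec l).1; have psi1 := (psi_spec 1%N).2 erefl.
have psi_f : \sum_(1 <= l < 16) psi l 0 <= eps ^+ 2.
  apply: le_trans Jf; rewrite J_split; apply: ler_sum => l _.
  have [_ _ <-] := psi_lifts l; first by rewrite displace0.
  by apply: box0; rewrite /lift_radius; lra.
have radii : (0 : R) <= pi / 8 < @lift_radius R.
  by rewrite /lift_radius; apply/andP; split; lra.
have Psi_tame : tame lift_radius (fun u => \sum_(1 <= l < 16) psi l u).
  by apply: tame_sum => l; have [] := psi_lifts l.
have [z zr z_min] := tame_minimizer radii Psi_tame.
exists (displace f z).
  exact: (lifted_minimizer psi_lifts eps_bounds Jf).
apply: grid_cvg_displace.
have c_gt0 : (0 < 15)%N by [].
have u_box n := iterate_closed_box psi_lifts psi1 c_gt0 lam_bounds eps_bounds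
  psi_f x_cppa n.
have [_ radii2] := andP radii.
apply: (cyclic_prox_cvg radii2 _ _ c_gt0 lambda_gt0 u_box _ zr z_min) => //.
- by move=> l; have [] := psi_lifts l.
- by move=> w; rewrite psi1.
- exact: (iterate_step psi_lifts psi1 c_gt0 lam_bounds eps_bounds psi_f x_cppa).
Qed.
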